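(* Let $(M,c,\sigma)$ be an almost Riemannian structure whose scale tractor $I$ has $I^2$ nowhere vanishing, and let $\Sigma$ be the zero locus of $\sigma$. Fix a weight $w_0$, set $h_0:=d+2w_0$, and assume $h_0\notin\mathbb Z_{\le 0}$. Let $\bar f_0\in\Gamma\mathcal T^\Phi M[-d-w_0+1]$ be an arbitrary extension to $M$ of given boundary data $\bar f_0|_\Sigma$. Then, for $\ell$ arbitrarily high, $$\bar f^{(\ell)}=\sigma^{h_0-1}\Big[\prod_{j=1}^{\ell}\frac{c_j}{j(1-j-h_0)}\Big]\bar f_0$$ is of the form $\bar f^{(\ell)}=\sigma^{h_0-1}\big(\bar f_0+\sigma\bar f_1+\sigma^2\bar f_2+\cdots+O(\sigma^{\ell+1})\big)$ with $\bar f_i\in\Gamma\mathcal T^\Phi M[-d-w_0+1-i]$, and solves, off $\Sigma$, $$y\,\bar f^{(\ell)}=O(\sigma^{h_0-1+\ell}).$$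
   Context: $M$ is a smooth manifold of dimension $d\ge3$ with conformal class $c$. $\mathcal EM[w]$ is the line bundle of conformal densities of weight $w$ (families of functions $\mu_g$, $g\in c$, with $\mu_{\Omega^2g}=\Omega^w\mu_g$); each $g\in c$ trivialises these. $\boldsymbol g$ is the conformal metric. For $g\in c$ the standard tractor bundle splits as $\mathcal TM\cong\mathcal EM[1]\oplus T^*M[1]\oplus\mathcal EM[-1]$, the triples $(\alpha,\mu_a,\beta)$ transforming under $\hat g=e^{2\omega}g$, $\Upsilon=d\omega$, by $(\alpha,\ \mu_b+\alpha\Upsilon_b,\ \beta-\Upsilon^c\mu_c-\tfrac12\alpha\Upsilon^c\Upsilon_c)$. It carries the tractor connection $\nabla_a(\alpha,\mu_b,\beta)=(\nabla_a\alpha-\mu_a,\ \nabla_a\mu_b+\boldsymbol g_{ab}\beta+P_{ab}\alpha,\ \nabla_a\beta-P_{ac}\mu^c)$ and the parallel tractor metric with quadratic form $\boldsymbol g^{-1}(\mu,\mu)+2\alpha\beta$. Here $P_{ab}$ is the Schouten tensor, $\mathrm{Ric}=(d-2)P+Jg$, $J=P^a{}_a$. $\mathcal T^\Phi M$ is any tensor bundle built from $\mathcal TM$, and $\mathcal T^\Phi M[w]=\mathcal T^\Phi M\otimes\mathcal EM[w]$. An almost Riemannian structure $(M,c,\sigma)$ is a conformal manifold with a section $\sigma\in\Gamma\mathcal EM[1]$ (defining scale) nowhere zero on an open dense set; here $\sigma$ is a defining density for $\Sigma$. Its scale tractor is, in a scale $g$, $I=(\sigma,\nu,\rho)$ with $\nu=\nabla\sigma$,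 $\rho=-\frac1d(\nabla^a\nabla_a\sigma+J\sigma)$, and $I^2=|\nu|^2+2\sigma\rho$. With $\nabla$ the coupled Levi-Civita/tractor connection, on $V\in\Gamma\mathcal T^\Phi M[w]$ the contraction of $I$ with the Thomas D-operator $D^AV=\big((d+2w-2)wV,\ (d+2w-2)\nabla_aV,\ -(\nabla^a\nabla_a+Jw)V\big)$ is $$I\cdot D\,V=(d+2w-2)(\nabla_\nu V+w\rho V)-\sigma(\nabla^a\nabla_a+Jw)V .$$ Operators: $xV=\sigma V$; $hV=(d+2w)V$; $yV=-\frac1{I^2}I\cdot D\,V$ (which lowers weight by one). For $j\in\mathbb Z$, $c_j:=xy+j(h-j-1)$. $O(\sigma^\alpha)$ means $\sigma^\alpha$ times a smooth section. *)

(* Defs.v *)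
From mathcomp Require Import all_boot all_order all_algebra all_fingroup.
From mathcomp Require Import all_classical all_reals all_analysis.
Import Order.TTheory GRing.Theory Num.Theory.
Import numFieldNormedType.Exports.
Set Implicit Arguments.
Unset Strict Implicit.
Unset Printing Implicit Defensive.
Local Open Scope classical_set_scope.
Local Open Scope ring_scope.

(** * Smooth functions and smooth manifolds *)

Definition partial (R : realType) (d : nat) (a : 'I_d) (f : 'rV[R]_d -> R) :
    'rV[R]_d -> R :=
  fun x => 'D_(delta_mx 0 a) f x.

Fixpoint Ck (R : realType) (d k : nat) (O : set 'rV[R]_d) (f : 'rV[R]_d -> R)
    : Prop :=
  (forall x, O x -> {for x, continuous f}) /\
  match k with
  | 0%N => True
  | k'.+1 => forall a : 'I_d,
      (forall x, O x -> derivable f x (delta_mx 0 a)) /\ Ck k' O (partial a f)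
  end.

Definition smooth_on (R : realType) (d : nat) (O : set 'rV[R]_d)
    (f : 'rV[R]_d -> R) : Prop := forall k, Ck k O f.

(* [cmap i] is a chart with domain [cdom i] and inverse [cinv i]; both maps are
   total, and only their values on [cdom i] and on its image matter. *)
Record manifold (R : realType) (d : nat) := Manifold {
  carrier :> topologicalType;
  chart : Type;
  cdom : chart -> set carrier;
  cmap : chart -> carrier -> 'rV[R]_d;
  cinv : chart -> 'rV[R]_d -> carrier;
  _ : hausdorff_space carrier;
  _ : @second_countable carrier;
  _ : forall i, open (cdom i);
  _ : forall p, exists i, cdom i p;
  _ : forall i, open (cmap i @` cdom i);
  _ : forall i p, cdom i p -> cinv i (cmap i p) = p;
  _ : forall i p, cdom i p -> {for p, continuous (cmap i)};
  _ : forall i x, (cmap i @` cdom i) x -> {for x, continuous (cinv i)};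
  _ : forall i j b, smooth_on (cmap i @` (cdom i `&` cdom j))
        (fun x => cmap j (cinv i x) 0 b) }.

(** Tractor indices: [inr true] is the slot of [alpha], [inl a] that of [mu_a]
    and [inr false] that of [beta]. *)
Definition tidx (d : nat) : Type := ('I_d + bool)%type.
Notation itop := (inr true).
Notation ibot := (inr false).

Section Geometry.
Variables (R : realType) (d : nat) (M : manifold R d).
Implicit Types (i : chart M) (a b c e : 'I_d) (p : M).

(* [pd i a f] is the partial derivative of [f] in the [a]-th coordinate of the
   chart [i], as a function on [cdom i]. *)
Definition pd i a (f : M -> R) (p : M) : R := partial a (f \o cinv i) (cmap i p).

Definition smooth_in i (f : M -> R) : Prop :=
  smooth_on (cmap i @` cdom i) (f \o cinv i).
Definition smooth_fun (f : M -> R) : Prop := forall i, smooth_in i f.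

Definition jac i (j : chart M) (p : M) : 'M[R]_d :=
  \matrix_(a, b) pd i a (fun q => cmap j q 0 b) p.

(** * Metrics, Levi-Civita connection, Schouten tensor *)

(* Covariant 2-tensor fields, given by their components in every chart. *)
Definition field2 := chart M -> M -> 'M[R]_d.

Definition is_field2 (T : field2) : Prop :=
  (forall i a b, smooth_in i (fun p => T i p a b)) /\
  (forall i j p, cdom i p -> cdom j p ->
     T i p = jac i j p *m T j p *m (jac i j p)^T).

(* Metrics of arbitrary signature. *)
Definition is_metric (g : field2) : Prop :=
  [/\ is_field2 g,
      (forall i p, cdom i p -> (g i p)^T = g i p) &
      (forall i p, cdom i p -> g i p \in unitmx)].

(* [gh = e^{2 om} g] *)
Definition rescaled (om : M -> R) (g gh : field2) : Prop :=
  smooth_fun om /\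
  forall i p, cdom i p -> gh i p = expR (2 * om p) *: g i p.

Definition is_conformal_class (c : set field2) : Prop :=
  [/\ c !=set0, (forall g, c g -> is_metric g) &
      (forall g gh, c g -> c gh <-> exists om, rescaled om g gh)].

(* Inverse metric g^{ab}, zero-order contraction [tr_g] and norm. *)
Definition ginv (g : field2) i (p : M) : 'M[R]_d := invmx (g i p).
Definition gtrace (g : field2) i (T : 'I_d -> 'I_d -> R) (p : M) : R :=
  \sum_a \sum_b ginv g i p a b * T a b.

(* Affine connections; [Gam i c a b] is Gamma^c_{ab} in the chart [i]. *)
Definition christoffel := chart M -> 'I_d -> 'I_d -> 'I_d -> M -> R.

Definition is_connection (Gam : christoffel) : Prop :=
  (forall i c a b, smooth_in i (Gam i c a b)) /\
  (forall i j p a b e, cdom i p -> cdom j p ->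
     \sum_c Gam i c a b p * jac i j p c e =
     \sum_c1 \sum_c2 Gam j e c1 c2 p * jac i j p a c1 * jac i j p b c2
     + pd i a (fun q => jac i j q b e) p).

Definition is_levi_civita (g : field2) (Gam : christoffel) : Prop :=
  [/\ is_connection Gam,
      (forall i p a b c, cdom i p -> Gam i c a b p = Gam i c b a p) &
      (forall i p a b c, cdom i p ->
         pd i a (fun q => g i q b c) p =
         \sum_e (Gam i e a b p * g i p e c + Gam i e a c p * g i p b e))].

(* Sign: positive on round spheres. *)
Definition ricci (Gam : christoffel) i (p : M) : 'M[R]_d :=
  \matrix_(a, b) \sum_c
    (pd i c (Gam i c a b) p - pd i b (Gam i c a c) p
     + \sum_e (Gam i c c e p * Gam i e a b p - Gam i c b e p * Gam i e a c p)).

Definition Jtrace (g P : field2) i (p : M) : R := gtrace g i (P i p) p.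

Definition is_schouten (g : field2) (Gam : christoffel) (P : field2) : Prop :=
  is_field2 P /\
  (forall i p, cdom i p ->
     ricci Gam i p = (d%:R - 2) *: P i p + Jtrace g P i p *: g i p).

(** * Conformal densities *)

(* Densities and tractors are families indexed by scales; only the values at
   the scales of the conformal class matter. *)
Definition density := field2 -> M -> R.

Definition is_density (c : set field2) (w : R) (mu : density) : Prop :=
  (forall g, c g -> smooth_fun (mu g)) /\
  (forall g gh om, c g -> rescaled om g gh ->
     forall p, mu gh p = expR (w * om p) * mu g p).

Definition zero_locus (c : set field2) (sigma : density) : set M :=
  [set p | forall g, c g -> sigma g p = 0].

Definition is_almost_riemannian (c : set field2) (sigma : density) : Prop :=
  [/\ is_conformal_class c, is_density c 1 sigma &
      exists O : set M, [/\ open O, dense O & O `<=` ~` zero_locus c sigma]].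

Definition is_defining_density (c : set field2) (sigma : density) : Prop :=
  forall g i p, c g -> cdom i p -> zero_locus c sigma p ->
    exists a, pd i a (sigma g) p != 0.

(** * Tractor tensors *)

(* Frame change from the chart [j] to the chart [i]. *)
Definition chart_tr i (j : chart M) (p : M) (A B : tidx d) : R :=
  match A, B with
  | itop, itop => 1
  | inl a, inl b => jac i j p a b
  | ibot, ibot => 1
  | _, _ => 0
  end.

(* Change of splitting from [g] to [e^{2 om} g].  The components are those of
   the weighted slots in the trivialisations given by the two metrics, whence
   the powers of [e^om]: the slots have weights 1, 1, -1. *)
Definition scale_tr (g : field2) (om : M -> R) i (p : M) (A B : tidx d) : R :=
  let Ups a := pd i a om p in
  match A, B with
  | itop, itop => expR (om p)
  | inl b, itop => expR (om p) * Ups b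
  | inl a, inl b => expR (om p) * (a == b)%:R
  | ibot, itop =>
      - expR (- om p) * (2^-1 * gtrace g i (fun a b => Ups a * Ups b) p)
  | ibot, inl b => - expR (- om p) * (\sum_a ginv g i p a b * Ups a)
  | ibot, ibot => expR (- om p)
  | _, _ => 0
  end.

(* Tractor metric on T and on its dual, in the frame attached to a scale with
   metric components [G]: [tmet G A B] are the coefficients of the bilinear form
   of g^{-1}(mu, mu) + 2 alpha beta, and [tmetinv G] is the inverse matrix. *)
Definition tmet (G : 'M[R]_d) (A B : tidx d) : R :=
  match A, B with
  | inl a, inl b => invmx G a b
  | itop, ibot | ibot, itop => 1
  | _, _ => 0
  end.
Definition tmetinv (G : 'M[R]_d) (A B : tidx d) : R :=
  match A, B with
  | inl a, inl b => G a b
  | itop, ibot | ibot, itop => 1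
  | _, _ => 0
  end.

Definition tensor (k : nat) := k.-tuple (tidx d) -> R.

(* Natural operations on tensor powers of T (identified with its dual by the
   tractor metric): permutation of the slots, contraction of the first two
   slots, product with the tractor metric, compositions and linear
   combinations. *)
Inductive tensor_op : nat -> nat -> Type :=
| OpPerm k (s : 'S_k) : tensor_op k k
| OpContract k : tensor_op k.+2 k
| OpMetric k : tensor_op k k.+2
| OpComp k l m : tensor_op l m -> tensor_op k l -> tensor_op k m
| OpLin k l : R -> tensor_op k l -> R -> tensor_op k l -> tensor_op k l.

Fixpoint op_sem (G : 'M[R]_d) k l (f : tensor_op k l) : tensor k -> tensor l :=
  match f in tensor_op k l return tensor k -> tensor l with
  | OpPerm k s => fun T A => T [tuple tnth A (s m) | m < k]
  | OpContract k => fun T A =>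
      \sum_B \sum_C tmet G B C * T [tuple of B :: C :: A]
  | OpMetric k => fun T A =>
      tmetinv G (thead A) (thead [tuple of behead A])
      * T [tuple of behead (behead A)]
  | OpComp k l m f1 f2 => fun T => op_sem G f1 (op_sem G f2 T)
  | OpLin k l x f1 y f2 => fun T A => x * op_sem G f1 T A + y * op_sem G f2 T A
  end.

(* A tensor bundle built from T: the kernel of a natural operation on a tensor
   power of T.  Every subbundle given by an invariant subspace for the
   orthogonal group is of this form, being the kernel of the complementary
   projection; the zero operation gives the whole power. *)
Record bundle := Bundle {
  rank : nat;
  target : nat;
  constraint : tensor_op rank target }.

(* Components, in one scale, of a section of a tensor power of T. *)
Definition tfield (k : nat) := chart M -> k.-tuple (tidx d) -> M -> R.

Definition tsection (Phi : bundle) := field2 -> tfield (rank Phi).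

Definition is_section (c : set field2) (Phi : bundle) (w : R)
    (V : tsection Phi) : Prop :=
  [/\ (forall g i A, c g -> smooth_in i (V g i A)),
      (forall g i j p A, c g -> cdom i p -> cdom j p ->
         V g i A p =
         \sum_B (\prod_m chart_tr i j p (tnth A m) (tnth B m)) * V g j B p),
      (forall g gh om i p A, c g -> rescaled om g gh -> cdom i p ->
         V gh i A p = expR (w * om p) *
         \sum_B (\prod_m scale_tr g om i p (tnth A m) (tnth B m)) * V g i B p) &
      (forall g i p A, c g -> cdom i p ->
         op_sem (g i p) (constraint Phi) (fun B => V g i B p) A = 0)].

(** * Operators in a scale

    [g] is a metric of the conformal class, [Gam] its Levi-Civita connection and
    [P] its Schouten tensor; [s] is the component function of the defining scale
    and [V] the components of a section of weight [w], all in the scale [g]. *)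
Section Scale.
Variables (g : field2) (Gam : christoffel) (P : field2) (s : M -> R).

(* The tractor connection in direction [a] on the frame components of T is
   [pd i a] plus this matrix. *)
Definition tcoef i a (A B : tidx d) (p : M) : R :=
  match A, B with
  | itop, inl b => - (a == b)%:R
  | inl b, itop => P i p a b
  | inl b, inl c => - Gam i c a b p
  | inl b, ibot => g i p a b
  | ibot, inl c => - \sum_b P i p a b * ginv g i p b c
  | _, _ => 0
  end.

Definition subst_slot k (A : k.-tuple (tidx d)) (m : 'I_k) (B : tidx d) :
    k.-tuple (tidx d) :=
  [tuple if n == m then B else tnth A n | n < k].

(* The coupled derivative nabla_a V.  There is no weight term because densities
   trivialised by [g] are differentiated as functions. *)
Definition tD k i a (V : k.-tuple (tidx d) -> M -> R)
    (A : k.-tuple (tidx d)) (p : M) : R :=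
  pd i a (V A) p
  + \sum_m \sum_B tcoef i a (tnth A m) B p * V (subst_slot A m B) p.

(* nabla_a nabla_b V *)
Definition tD2 k i a b (V : k.-tuple (tidx d) -> M -> R)
    (A : k.-tuple (tidx d)) (p : M) : R :=
  tD i a (tD i b V) A p - \sum_c Gam i c a b p * tD i c V A p.

Definition tlap k i (V : k.-tuple (tidx d) -> M -> R)
    (A : k.-tuple (tidx d)) (p : M) : R :=
  gtrace g i (fun a b => tD2 i a b V A p) p.

Definition lap i (f : M -> R) (p : M) : R :=
  gtrace g i (fun a b =>
    pd i a (pd i b f) p - \sum_c Gam i c a b p * pd i c f p) p.

Definition nu i a (p : M) : R := pd i a s p.
Definition rho i (p : M) : R :=
  - (d%:R)^-1 * (lap i s p + Jtrace g P i p * s p).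
Definition Isq i (p : M) : R :=
  gtrace g i (fun a b => nu i a p * nu i b p) p + 2 * s p * rho i p.

Definition IdotD k (w : R) (V : tfield k) : tfield k := fun i A p =>
  (d%:R + 2 * w - 2) *
    (gtrace g i (fun a b => nu i a p * tD i b (V i) A p) p
     + w * rho i p * V i A p)
  - s p * (tlap i (V i) A p + Jtrace g P i p * w * V i A p).

Definition opx k (V : tfield k) : tfield k := fun i A p => s p * V i A p.
Definition oph k (w : R) (V : tfield k) : tfield k :=
  fun i A p => (d%:R + 2 * w) * V i A p.
Definition opy k (w : R) (V : tfield k) : tfield k :=
  fun i A p => - (Isq i p)^-1 * IdotD w V i A p.

(* c_j = x y + j (h - j - 1) on weight [w] *)
Definition opc k (w : R) (j : nat) (V : tfield k) : tfield k := fun i A p =>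
  opx (opy w V) i A p
  + j%:R * (oph w V i A p - (j%:R + 1) * V i A p).

(* c_1 / (1 (1 - 1 - h0)) o ... o c_l / (l (1 - l - h0)) on weight [w] *)
Definition opc_prod k (w h0 : R) (l : nat) (V : tfield k) : tfield k :=
  foldr (fun j (U : tfield k) => fun i A p =>
           (j%:R * (1 - j%:R - h0))^-1 * opc w j U i A p) V (iota 1 l).

End Scale.

End Geometry.

(* Powers [s^al] for [s != 0] and real [al], of either sign of [s]: the integer
   power when [al] is an integer, and [|s|^al] otherwise.  For [s < 0] the second
   case has [spow s (al + 1) = - s * spow s al], so [O(s^(al + l))] should be
   read as [s^al s^l] times a smooth section. *)
Definition spow (R : realType) (s al : R) : R :=
  if al \is a Num.int then s ^ Num.floor al else `|s| `^ al.

(* Main.v *)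
Require Import Defs.
From HB Require Import structures.
From mathcomp Require Import all_boot all_order all_algebra all_fingroup.
From mathcomp Require Import all_classical all_reals all_analysis.
From mathcomp Require Import ring.
Import Order.TTheory GRing.Theory Num.Theory.
Import numFieldNormedType.Exports.
Set Implicit Arguments.
Unset Strict Implicit.
Unset Printing Implicit Defensive.
Local Open Scope classical_set_scope.
Local Open Scope ring_scope.

(* All operators are taken in the one scale [g], where sections have no weight.
   Let [w] be the weight of [f0], so that [d + 2 w = 2 - h0].  The relation
   [x, y] = h, obtained by expanding [I.D (sigma V)], gives
   [y c_j = c_(j-1) y].  Hence [y c_1 ... c_l = c_0 c_1 ... c_(l-1) y], and since
   [c_0 = x y], induction on [l] turns this into [x^l y^(l+1)].  Off the zero
   locus, [y (sigma^(h0-1) V) = sigma^(h0-1) (y V)] for [V] of weight [w], because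
   the terms in [I^2] and [rho] cancel for exactly this exponent.  Moreover
   [c_j / (j (1-j-h0)) = 1 + x y / (j (1-j-h0))] on weight [w], so the product has
   the form [f0 + sigma G].

   To be a section in the sense of the definitions, a result must transform
   correctly between charts and satisfy the constraint of the bundle, which
   holds because the coupled connection is chart covariant and commutes with all
   natural tensor operations (the tractor metric being parallel).  It is then
   propagated to all scales of the conformal class by the transformation law
   itself, so no conformal invariance of [I.D] is needed. *)

(** * Differential calculus *)

(** Two numerical facts drive the algebra. With D = d + 2 w, moving [y] past c_(j+1) costs -(D - 2),
    and (j+1)(D - j - 2) - (D - 2) = j((D - 2) - j - 1) is the scalar of c_j at the weight w - 1 of
    [y V]; this dictates the quadratic scalar in c_j. For D = 2 - h0 it equals j(1 - j - h0), so the
    normalising constants make each factor the identity modulo [x], and the excluded values of h0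
    are those at which one of these scalars vanishes. The exponent h0 - 1 is the root al = d + 2 w0
    - 1 of al (d + 2 w0 - 1 - al) = 0, the left side being the coefficient of sigma^(al-1) |nu|^2 V
    in I.D (sigma^al V).

    The algebra is short; the bulk is geometric. Smoothness is given through iterated partial
    derivatives of components in charts, so total differentiability, the chain rule, the tensorial
    behaviour of second derivatives and the parallelism of the tractor metric all have to be
    obtained in coordinates. *)

Lemma is_derive_line (R : realType) (V W : normedModType R) (F : V -> W)
    (z v : V) (s : R) l :
  is_derive (s *: v + z) v F l ->
  is_derive s (1 : R) (fun r : R => F (r *: v + z)) l.
Proof.
have e : (fun h : R => h^-1 *: (((fun r : R => F (r *: v + z)) \o shift s)
      (h *: (1 : R)) - F (s *: v + z))) =
    (fun h : R => h^-1 *: ((F \o shift (s *: v + z)) (h *: v) - F (s *: v + z))).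
  by apply/funext => h /=; rewrite scaler1 scalerDl addrA.
by case=> d1 d2; apply: DeriveDef; [rewrite /derivable e|rewrite /derive e].
Qed.

(** The one-variable mean value theorem on the line through [z]. The bound on |s| in place of an
    interval spares callers a case split on the sign of [t]. *)
Lemma mvt_direction (R : realType) (V : normedModType R) (F : V -> R) (z v : V)
    (t : R) :
  (forall s : R, `|s| <= `|t| -> derivable F (s *: v + z) v) ->
  exists2 s : R, `|s| <= `|t| & F (t *: v + z) - F z = 'D_v F (s *: v + z) * t.
Proof.
move=> dF.
have dg (s : R) : `|s| <= `|t| ->
    is_derive s (1 : R) (fun r : R => F (r *: v + z)) ('D_v F (s *: v + z)).
  by move=> /dF/derivableP/is_derive_line.
have cg (s : R) : `|s| <= `|t| -> {for s, continuous (fun r : R => F (r *: v + z))}.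
  by move=> /dg [/derivable1_diffP /differentiable_continuous].
have [t0|t0] := leP 0 t.
- have [||s /andP[]] := @MVT_segment R (fun r : R => F (r *: v + z))
    (fun s => 'D_v F (s *: v + z)) 0 t t0.
  + move=> s /andP[] /[!bnd_simp] s0 st; apply: dg.
    by rewrite !ger0_norm// ltW.
  + apply: continuous_in_subspaceT => s.
    rewrite inE/= in_itv/= => /andP[s0 st]; apply: cg.
    by rewrite !ger0_norm.
  move=> /[!bnd_simp] s0 st; rewrite scale0r add0r subr0 => ->.
  by exists s => //; rewrite !ger0_norm.
- have [||s /andP[]] := @MVT_segment R (fun r : R => F (r *: v + z))
    (fun s => 'D_v F (s *: v + z)) t 0 (ltW t0).
  + move=> s /andP[] /[!bnd_simp] s0 st; apply: dg.
    by rewrite !ltr0_norm ?lerN2 ?ltW.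
  + apply: continuous_in_subspaceT => s.
    rewrite inE/= in_itv/= => /andP[s0 st]; apply: cg.
    by rewrite !ler0_norm ?lerN2// ltW.
  move=> /[!bnd_simp] s0 st; rewrite scale0r add0r sub0r mulrN => /(congr1 -%R).
  rewrite opprB opprK => e.
  by exists s; rewrite // !ler0_norm ?lerN2// ltW.
Qed.

(** [Ck] speaks of partial derivatives only, whereas the chain rule for a change of chart needs
    total differentiability. The increment is split into [d] steps parallel to the axes, each
    controlled by the mean value theorem. *)
Lemma C1_differentiable (R : realType) (d : nat) (F : 'rV[R]_d -> R)
    (y : 'rV[R]_d) :
  (\forall x \near y, forall a, derivable F x (delta_mx 0 a)) ->
  (forall a, {for y, continuous (partial a F)}) ->
  differentiable F y.
Proof.
move=> dF cF.
pose L (h : 'rV[R]_d) := \sum_a h 0 a * partial a F y.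
have linL : linear L.
  move=> k u v; rewrite /L scaler_sumr -big_split/=; apply: eq_bigr => a _.
  by rewrite !mxE mulrDl -mulrA.
pose scL := GRing.isLinear.Build _ _ _ _ _ linL.
pose LL : {linear 'rV[R]_d -> R} := HB.pack L scL.
have cL : continuous LL.
  rewrite /= /L; elim: (index_enum _) => [|b r IH].
    by under eq_fun do rewrite big_nil; exact: cst_continuous.
  under eq_fun do rewrite big_cons.
  move=> h; apply: (@continuousD _ _ _ (fun h : 'rV[R]_d => h 0 b * partial b F y)
    (fun h : 'rV[R]_d => \sum_(a <- r) h 0 a * partial a F y)); last exact: IH.
  apply: (@continuousM _ _ (fun h : 'rV[R]_d => h 0 b) (cst (partial b F y))).
    exact: coord_continuous.
  exact: cst_continuous.
(* One little-o estimate serves twice: [diff_unique] uses it to identify the differential with [L],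
   and then it is itself the differentiability claim. *)
suff H (e : R) : 0 < e -> \forall h \near (0 : 'rV[R]_d),
    `|F (h + y) - (F y + L h)| <= e * `|h|.
  apply/diff_locallyP; rewrite (@diff_unique R _ R F LL y cL).
    by split => //; apply/eqaddoP; exact: H.
  by apply/eqaddoP; exact: H.
move=> e0.
(* The share of [e] granted to each of the [d] steps; dividing by [d.+1] also covers d = 0. *)
have e'0 : 0 < e / (d.+1)%:R by rewrite divr_gt0.
have cF' a : \forall x \near y,
    `|partial a F y - partial a F x| < e / (d.+1)%:R.
  by move/cvgrPdist_lt : (cF a); apply.
have : \forall x \near y, forall a : 'I_d, derivable F x (delta_mx 0 a) /\
    `|partial a F y - partial a F x| < e / (d.+1)%:R.
  near=> x => a; split; first by move: a; near: x.
  by move: a; near: x; exact: filter_forall.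
move=> /nbhs_ballP [r /= r0 Hr].
near=> h.
have hr : `|h| < r.
  by near: h; exact: cvgr0_norm_lt.
(* [H k] keeps the first [k] coordinates of [h]: consecutive points differ along one axis, and the
   segments between them stay in the ball where the partial derivatives are controlled. *)
pose H k : 'rV[R]_d := \row_a (if (a < k)%N then h 0 a else 0).
have Hd : H d = h by apply/rowP => a; rewrite mxE ltn_ord.
have H0 : H 0%N = 0 by apply/rowP => a; rewrite !mxE.
have HS (a : 'I_d) : H a.+1 = h 0 a *: delta_mx 0 a + H a.
  apply/rowP => b; rewrite !mxE eqxx/= ltnS leq_eqVlt val_eqE.
  have [->|_] := eqVneq b a; first by rewrite mulr1 ltnn addr0.
  by rewrite mulr0 add0r.
have hb a : `|h 0 a| <= `|h|.
  by rewrite [leRHS]/Num.Def.normr/= mx_normrE (le_bigmax _ (fun ij => `|h ij.1 ij.2|) (0, a)).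
have bH (a : 'I_d) s : `|s| <= `|h 0 a| -> ball y r (s *: delta_mx 0 a + (H a + y)).
  move=> sa; rewrite -ball_normE /= addrA opprD addrCA subrr addr0 normrN.
  apply: le_lt_trans hr; rewrite [leLHS]/Num.Def.normr/= mx_normrE.
  apply: bigmax_le => // -[i b] _ /=; rewrite !mxE ord1 eqxx/=.
  have [->|ba] := eqVneq b a; first by rewrite mulr1 ltnn addr0 (le_trans sa).
  by rewrite mulr0 add0r; case: ifP; rewrite ?normr0.
have inc (a : 'I_d) : exists2 q, `|q| <= e / (d.+1)%:R * `|h| &
    F (H a.+1 + y) - F (H a + y) = h 0 a * partial a F y + q.
  have [|s sa] := @mvt_direction R _ F (H a + y) (delta_mx 0 a) (h 0 a).
    by move=> s /bH/Hr/(_ a)[].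
  rewrite addrA -HS => ->.
  exists (('D_(delta_mx 0 a) F (s *: delta_mx 0 a + (H a + y)) - partial a F y) * h 0 a).
    rewrite normrM ler_pM// distrC ltW//.
    by have /Hr/(_ a)[] := bH a s sa.
  by rewrite /partial; ring.
have [q Hq] := choice (fun a => let: ex_intro2 q h1 h2 := inc a in
  ex_intro (fun q => _ /\ _) q (conj h1 h2)).
have -> : F (h + y) - (F y + L h) = \sum_a q a.
  rewrite opprD addrA.
  have <- : \sum_(0 <= k < d) (F (H k.+1 + y) - F (H k + y)) = F (h + y) - F y.
    by rewrite telescope_sumr// Hd H0 add0r.
  rewrite big_mkord -sumrB; apply: eq_bigr => a _.
  by have [_ ->] := Hq a; rewrite addrC addKr.
apply: le_trans (ler_norm_sum _ _ _) _.
apply: (@le_trans _ _ (\sum_(a < d) e / (d.+1)%:R * `|h|)).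
  by apply: ler_sum => a _; have [] := Hq a.
rewrite sumr_const card_ord -mulrnAl ler_wpM2r// -mulr_natr -mulrA ler_piMr ?ltW//.
by rewrite mulrC ltr_pdivrMr// mul1r ltr_nat.
Unshelve. all: by end_near. Qed.

(** * Directional derivatives of composites, products and inverses *)

Section IsDerive.
Variables (R : realType) (V : normedModType R).
Implicit Types (f g : V -> R) (x v : V).

(** Only the derivative of [f] in the direction [v] is assumed, so the chain rule for differentials
    does not apply to [f] directly. Along the line through [x] it becomes a function of one
    variable, for which derivable and differentiable agree. *)
Lemma is_derive_comp (U W : normedModType R) (f : V -> U) (F : U -> W) x v l :
  is_derive x v f l -> differentiable F (f x) ->
  is_derive x v (F \o f) ('d F (f x) l).
Proof.
move=> [dfx fl] dF.
have e : x = (0 : R) *: v + x by rewrite scale0r add0r.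
pose h (r : R) := f (r *: v + x).
have h0 : h 0 = f x by rewrite /h -e.
have hh : is_derive (0 : R) (1 : R) h l.
  by apply: is_derive_line; rewrite -e; apply: DeriveDef.
have dh : differentiable h 0 by apply/derivable1_diffP; case: hh.
have dF' : differentiable F (h 0) by rewrite h0.
have dFh : differentiable (F \o h) 0 by exact: differentiable_comp.
have D : 'D_1 (F \o h) (0 : R) = 'd F (f x) l.
  rewrite deriveE// diff_comp//= h0; congr ('d F (f x) _).
  by rewrite -deriveE//; case: hh.
have dd : derivable (F \o f) x v by apply/derivable1P/derivable1_diffP.
apply: DeriveDef => //.
have : is_derive (0 : R) (1 : R) (F \o h) ('D_v (F \o f) x).
  by apply: (@is_derive_line _ _ _ (F \o f)); rewrite -e; apply: DeriveDef.
by case=> _ <-.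
Qed.

Lemma is_derive_comp1 f (phi : R -> R) x v l m :
  is_derive x v f l -> is_derive (f x) (1 : R) phi m ->
  is_derive x v (fun y => phi (f y)) (m * l).
Proof.
move=> fl [/derivable1_diffP dphi pm].
have := is_derive_comp fl dphi; rewrite diff1E// derive1E pm.
by rewrite /GRing.scale/= mulrC.
Qed.

Lemma is_derive_fM f g x v a b : is_derive x v f a -> is_derive x v g b ->
  is_derive x v (fun y => f y * g y) (a * g x + f x * b).
Proof.
move=> fa gb; have h := is_deriveM fa gb; apply: (is_derive_eq h).
by rewrite /GRing.scale/= addrC mulrC [X in _ + X]mulrC mulrC addrC.
Qed.

Lemma is_derive_fD f g x v a b : is_derive x v f a -> is_derive x v g b ->
  is_derive x v (fun y => f y + g y) (a + b).
Proof. by move=> fa gb; exact: (is_deriveD fa gb). Qed.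

Lemma is_derive_fc (c : R) x v : is_derive x v (fun=> c) 0.
Proof. exact: is_derive_cst. Qed.

Lemma is_derive_fsum (I : Type) (r : seq I) (F : I -> V -> R) (D : I -> R) x v :
  (forall i, is_derive x v (F i) (D i)) ->
  is_derive x v (fun y => \sum_(i <- r) F i y) (\sum_(i <- r) D i).
Proof.
move=> FD; elim: r => [|i r IH].
  under eq_fun do rewrite big_nil; rewrite big_nil; exact: is_derive_fc.
under eq_fun do rewrite big_cons; rewrite big_cons; exact: is_derive_fD.
Qed.

Lemma is_derive_fprod (I : finType) (F : I -> V -> R) (D : I -> R) x v :
  (forall i, is_derive x v (F i) (D i)) ->
  is_derive x v (fun y => \prod_i F i y)
    (\sum_i D i * \prod_(j | j != i) F j x).
Proof.
move=> FD.
(* Without repetitions the condition [j != i] removes exactly one factor, which is what the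
   induction on lists needs. *)
suff H (r : seq I) : uniq r -> is_derive x v (fun y => \prod_(i <- r) F i y)
    (\sum_(i <- r) D i * \prod_(j <- r | j != i) F j x).
  exact: H (index_enum_uniq _).
elim: r => [|i r IH].
  by under eq_fun do rewrite big_nil; rewrite big_nil => _; exact: is_derive_fc.
move=> /= /andP[ir ur]; under eq_fun do rewrite big_cons; rewrite big_cons.
apply: is_derive_eq; first exact: (is_derive_fM (FD i) (IH ur)).
congr (_ + _).
  rewrite big_cons eqxx/=; congr (_ * _).
  rewrite big_seq [RHS]big_seq_cond; apply: eq_bigl => j.
  by case: (boolP (j \in r)) => //= jr; apply/esym; apply: contraNneq ir => <-.
rewrite mulr_sumr big_seq [RHS]big_seq; apply: eq_bigr => j jr.
rewrite big_cons ifT 1?mulrCA//.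
by apply: contraNneq ir => ->.
Qed.

Lemma is_derive_fV f x v a : f x != 0 -> is_derive x v f a ->
  is_derive x v (fun y => (f y)^-1) (- (f x)^-1 ^+ 2 * a).
Proof.
move=> fx0 [df <-]; apply: DeriveDef; first exact: derivableV.
rewrite (@deriveV _ _ f)// /GRing.scale/=; by rewrite exprVn.
Qed.

End IsDerive.

Lemma partialP (R : realType) d (a : 'I_d) (f : 'rV[R]_d -> R) x :
  derivable f x (delta_mx 0 a) -> is_derive x (delta_mx 0 a) f (partial a f x).
Proof. by move=> df; apply: DeriveDef. Qed.

Lemma partial_val (R : realType) d (a : 'I_d) (f : 'rV[R]_d -> R) x l :
  is_derive x (delta_mx 0 a) f l -> partial a f x = l.
Proof. by case. Qed.

Lemma near_eq_continuous_at (T U : topologicalType) (f g : T -> U) (x : T) :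
  {near x, f =1 g} -> {for x, continuous f} -> {for x, continuous g}.
Proof.
move=> fg; rewrite /continuous_at /prop_for /= (nbhs_singleton fg).
apply: cvg_trans; apply: near_eq_cvg; near=> y; near: y.
Unshelve. all: by end_near. Qed.

(** * Functions of class C^k on open sets *)

Section SmoothOn.
Variables (R : realType) (d : nat).
Implicit Types (O : set 'rV[R]_d) (f g : 'rV[R]_d -> R) (k : nat).

Lemma Ck_sub k O O' f : O' `<=` O -> Ck k O f -> Ck k O' f.
Proof.
move=> sO; elim: k f => [|k IH] f /= [cf H]; (split; first by move=> x /sO/cf) => //.
by move=> a; have [df Hf] := H a; split; [move=> x /sO/df|exact: IH].
Qed.

Lemma CkS k O f : Ck k.+1 O f -> Ck k O f.
Proof.
elim: k f => [|k IH] f [cf H]; split => // a.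
by have [df Hf] := H a; split => //; exact: IH.
Qed.

Lemma Ck_cont k O f x : Ck k O f -> O x -> {for x, continuous f}.
Proof. by case: k => [|k] [cf _] /cf. Qed.

(** Openness turns agreement on [O] into agreement near each of its points, so the partial
    derivatives agree on [O] as well. *)
Lemma Ck_eq k O f g : open O -> (forall x, O x -> f x = g x) ->
  Ck k O f -> Ck k O g.
Proof.
move=> oO; elim: k f g => [|k IH] f g fg [cf H].
all: have nfg x : O x -> {near x, f =1 g}
  by move=> Ox; near=> y; apply: fg; near: y; exact: open_nbhs_nbhs.
all: have cg x : O x -> {for x, continuous g}
  by move=> Ox; exact: near_eq_continuous_at (nfg x Ox) (cf x Ox).
all: split => // a; have [df Hf] := H a; split.
  by move=> x Ox; exact: near_eq_derivable (nfg x Ox) (df x Ox).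
apply: IH Hf => x Ox.
by apply: near_eq_derive; exact: nfg.
Unshelve. all: by end_near. Qed.

(** The closure properties below go through this: it suffices to give the partial derivatives by a
    formula that the induction hypothesis covers. *)
Lemma Ck_build k O f (D : 'I_d -> 'rV[R]_d -> R) : open O ->
  (forall x, O x -> {for x, continuous f}) ->
  (forall a x, O x -> is_derive x (delta_mx 0 a) f (D a x)) ->
  (forall a, Ck k O (D a)) -> Ck k.+1 O f.
Proof.
move=> oO cf df HD; split => // a; split=> [x /(df a)[]//|].
apply: Ck_eq (HD a) => // x /(df a) h; by rewrite (partial_val h).
Qed.

Lemma Ck_pd k O f a x : Ck k.+1 O f -> O x ->
  is_derive x (delta_mx 0 a) f (partial a f x).
Proof. by move=> [_ /(_ a)[df _]] /df/partialP. Qed.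

Lemma Ck_cst k O (c : R) : open O -> Ck k O (fun=> c).
Proof.
move=> oO; elim: k c => [|k IH] c.
  by split=> // x _; exact: cst_continuous.
apply: (@Ck_build _ _ _ (fun _ _ => 0)) => // x _.
exact: cst_continuous.
Qed.

Lemma Ck_add k O f g : open O -> Ck k O f -> Ck k O g ->
  Ck k O (fun x => f x + g x).
Proof.
move=> oO; elim: k f g => [|k IH] f g Hf Hg.
  by split=> // x Ox; apply: (@continuousD _ _ _ f g);
    [exact: Ck_cont Hf Ox|exact: Ck_cont Hg Ox].
apply: (@Ck_build _ _ _ (fun a x => partial a f x + partial a g x)) => //.
- by move=> x Ox; apply: (@continuousD _ _ _ f g);
    [exact: Ck_cont Hf Ox|exact: Ck_cont Hg Ox].
- by move=> a x Ox; apply: is_derive_fD; [exact: Ck_pd Hf Ox|exact: Ck_pd Hg Ox].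
- by move=> a; apply: IH; [case: Hf => _ /(_ a)[]|case: Hg => _ /(_ a)[]].
Qed.

Lemma Ck_mul k O f g : open O -> Ck k O f -> Ck k O g ->
  Ck k O (fun x => f x * g x).
Proof.
move=> oO; elim: k f g => [|k IH] f g Hf Hg.
  by split=> // x Ox; apply: (@continuousM _ _ f g);
    [exact: Ck_cont Hf Ox|exact: Ck_cont Hg Ox].
apply: (@Ck_build _ _ _
    (fun a x => partial a f x * g x + f x * partial a g x)) => //.
- by move=> x Ox; apply: (@continuousM _ _ f g);
    [exact: Ck_cont Hf Ox|exact: Ck_cont Hg Ox].
- by move=> a x Ox; apply: is_derive_fM; [exact: Ck_pd Hf Ox|exact: Ck_pd Hg Ox].
- move=> a; apply: Ck_add => //; apply: IH.
  + by case: Hf => _ /(_ a)[].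
  + exact: CkS.
  + exact: CkS.
  + by case: Hg => _ /(_ a)[].
Qed.

Lemma Ck_inv k O f : open O -> (forall x, O x -> f x != 0) -> Ck k O f ->
  Ck k O (fun x => (f x)^-1).
Proof.
move=> oO f0; elim: k => [|k IH] Hf.
  by split=> // x Ox; apply: continuousV; [exact: f0|exact: Ck_cont Hf Ox].
apply: (@Ck_build _ _ _
    (fun a x => -1 * ((f x)^-1 * (f x)^-1 * partial a f x))) => //.
- by move=> x Ox; apply: continuousV; [exact: f0|exact: Ck_cont Hf Ox].
- move=> a x Ox; apply: is_derive_eq.
    exact: (is_derive_fV (f0 x Ox) (Ck_pd a Hf Ox)).
  by rewrite expr2 mulN1r mulNr.
- have Hi := IH (CkS Hf).
  move=> a; apply: Ck_mul => //; first exact: Ck_cst.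
  apply: Ck_mul => //; first exact: Ck_mul.
  by case: Hf => _ /(_ a)[].
Qed.

Lemma Ck_exp k O f : open O -> Ck k O f -> Ck k O (fun x => expR (f x)).
Proof.
move=> oO; elim: k => [|k IH] Hf.
  by split=> // x Ox; apply: continuous_comp;
    [exact: Ck_cont Hf Ox|exact: continuous_expR].
apply: (@Ck_build _ _ _ (fun a x => expR (f x) * partial a f x)) => //.
- by move=> x Ox; apply: continuous_comp;
    [exact: Ck_cont Hf Ox|exact: continuous_expR].
- by move=> a x Ox; apply: is_derive_comp1; exact: Ck_pd Hf Ox.
- move=> a; apply: Ck_mul => //; first exact: IH (CkS Hf).
  by case: Hf => _ /(_ a)[].
Qed.

Lemma Ck_pd_smooth k O f a : smooth_on O f -> Ck k O (partial a f).
Proof. by move=> /(_ k.+1)[_ /(_ a)[]]. Qed.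

Lemma smooth_on_differentiable O f x : open O -> smooth_on O f -> O x ->
  differentiable f x.
Proof.
move=> oO Hf Ox; apply: C1_differentiable.
  near=> y => a; have [_ /(_ a)[+ _]] := Hf 1%N; apply.
  by near: y; exact: open_nbhs_nbhs.
by move=> a; exact: Ck_cont (Ck_pd_smooth 0 a Hf) Ox.
Unshelve. all: by end_near. Qed.

Lemma diff_partial f (x v : 'rV[R]_d) : differentiable f x ->
  'd f x v = \sum_a v 0 a * partial a f x.
Proof.
move=> df; rewrite {1}[v]row_sum_delta linear_sum; apply: eq_bigr => a _.
by rewrite linearZ/= /partial deriveE.
Qed.

End SmoothOn.

Lemma is_derive_chain (R : realType) (d e : nat) (H : 'rV[R]_d -> 'rV[R]_e)
    (F : 'rV[R]_e -> R) x v (l : 'I_e -> R) :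
  (forall b, is_derive x v (fun y => H y 0 b) (l b)) ->
  differentiable F (H x) ->
  is_derive x v (fun y => F (H y)) (\sum_b l b * partial b F (H x)).
Proof.
move=> Hl dF.
have dH : derivable H x v.
  by apply/derivable_mxP => i b; rewrite ord1; case: (Hl b).
have := is_derive_comp (derivableP dH) dF.
rewrite diff_partial// derive_mx//.
under eq_bigr do rewrite mxE; move=> h; apply: is_derive_eq h _.
by apply: eq_bigr => b _; case: (Hl b) => _ ->.
Qed.

(** * Calculus in charts *)

Section Charts.
Variables (R : realType) (d : nat) (M : manifold R d).
Implicit Types (i j : chart M) (a b : 'I_d) (p : M) (W : set M) (f g : M -> R).

Lemma cdom_open i : open (cdom i). Proof. by case: M i. Qed.
Lemma cdom_cover p : exists i, cdom i p. Proof. by case: M p. Qed.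
Lemma cmap_open i : open (cmap i @` cdom i). Proof. by case: M i. Qed.
Lemma cinvK i p : cdom i p -> cinv i (cmap i p) = p.
Proof. by case: M i p. Qed.
Lemma cinv_continuous i x :
  (cmap i @` cdom i) x -> {for x, continuous (cinv i)}.
Proof. by case: M i x. Qed.
Lemma cmap_continuous i p : cdom i p -> {for p, continuous (cmap i)}.
Proof. by case: M i p. Qed.
Lemma transition_smooth i j b :
  smooth_on (cmap i @` (cdom i `&` cdom j)) (fun x => cmap j (cinv i x) 0 b).
Proof. by case: M i j b. Qed.

(** The set [W] is there for functions smooth on only part of a chart: Jacobians live on overlaps,
    powers of sigma off its zero locus. *)
Definition sm i W f : Prop :=
  smooth_on (cmap i @` (cdom i `&` W)) (f \o cinv i).

(** Carries derivability along with the value, because [pd] returns a value even where no derivative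
    exists. *)
Definition ispd i a f p (l : R) : Prop :=
  is_derive (cmap i p) (delta_mx 0 a) (f \o cinv i) l.

Lemma image_open i W : open W -> open (cmap i @` (cdom i `&` W)).
Proof.
move=> oW; rewrite openE => _ [p [ip Wp] <-].
rewrite /interior; near=> y.
have [q iq qy] : (cmap i @` cdom i) y.
  near: y; apply: open_nbhs_nbhs; split; [exact: cmap_open|by exists p].
exists q => //; split => //; rewrite -(cinvK iq) qy; near: y.
have := @cinv_continuous i (cmap i p) (ex_intro2 _ _ p ip erefl).
apply; rewrite cinvK//; exact: open_nbhs_nbhs.
Unshelve. all: by end_near. Qed.

Lemma sm_setT i f : sm i setT f = smooth_in i f.
Proof. by rewrite /sm setIT. Qed.

Lemma sm_sub i W W' f : W' `<=` W -> sm i W f -> sm i W' f.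
Proof.
move=> sW Hf k; apply: Ck_sub (Hf k) => _ [p [ip Wp] <-].
by exists p => //; split => //; exact: sW.
Qed.

Lemma sm_in i W f : smooth_in i f -> sm i W f.
Proof. by rewrite -sm_setT; exact: sm_sub. Qed.

Lemma sm_eq i W f g : open W -> (forall p, cdom i p -> W p -> f p = g p) ->
  sm i W f -> sm i W g.
Proof.
move=> oW fg Hf k; apply: Ck_eq (Hf k); first exact: image_open.
by move=> _ [p [ip Wp] <-] /=; rewrite cinvK// fg.
Qed.

Lemma sm_cst i W (c : R) : open W -> sm i W (fun=> c).
Proof. by move=> oW k; apply: Ck_cst; exact: image_open. Qed.

Lemma sm_add i W f g : open W -> sm i W f -> sm i W g ->
  sm i W (fun p => f p + g p).
Proof.
move=> oW Hf Hg k; apply: (Ck_add _ (Hf k) (Hg k)); exact: image_open.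
Qed.

Lemma sm_mul i W f g : open W -> sm i W f -> sm i W g ->
  sm i W (fun p => f p * g p).
Proof.
move=> oW Hf Hg k; apply: (Ck_mul _ (Hf k) (Hg k)); exact: image_open.
Qed.

Lemma sm_opp i W f : open W -> sm i W f -> sm i W (fun p => - f p).
Proof.
move=> oW Hf; under [X in sm _ _ X]eq_fun do rewrite -mulN1r.
by apply: sm_mul => //; exact: sm_cst.
Qed.

Lemma sm_sub2 i W f g : open W -> sm i W f -> sm i W g ->
  sm i W (fun p => f p - g p).
Proof. by move=> oW Hf Hg; apply: sm_add => //; exact: sm_opp. Qed.

Lemma sm_inv i W f : open W -> (forall p, cdom i p -> W p -> f p != 0) ->
  sm i W f -> sm i W (fun p => (f p)^-1).
Proof.
move=> oW f0 Hf k; apply: (Ck_inv _ _ (Hf k)); first exact: image_open.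
by move=> _ [p [ip Wp] <-] /=; rewrite cinvK// f0.
Qed.

Lemma sm_exp i W f : open W -> sm i W f -> sm i W (fun p => expR (f p)).
Proof.
by move=> oW Hf k; apply: (Ck_exp _ (Hf k)); exact: image_open.
Qed.

Lemma sm_sum (I : Type) (r : seq I) (P : pred I) i W (F : I -> M -> R) :
  open W -> (forall k, sm i W (F k)) ->
  sm i W (fun p => \sum_(k <- r | P k) F k p).
Proof.
move=> oW HF; elim: r => [|k r IH].
  by under [X in sm _ _ X]eq_fun do rewrite big_nil; exact: sm_cst.
under [X in sm _ _ X]eq_fun do rewrite big_cons.
by case: (P k) => //; exact: sm_add.
Qed.

Lemma sm_prod (I : Type) (r : seq I) (P : pred I) i W (F : I -> M -> R) :
  open W -> (forall k, sm i W (F k)) ->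
  sm i W (fun p => \prod_(k <- r | P k) F k p).
Proof.
move=> oW HF; elim: r => [|k r IH].
  by under [X in sm _ _ X]eq_fun do rewrite big_nil; exact: sm_cst.
under [X in sm _ _ X]eq_fun do rewrite big_cons.
by case: (P k) => //; exact: sm_mul.
Qed.

Lemma sm_det n i W (A : M -> 'M[R]_n) : open W ->
  (forall a b : 'I_n, sm i W (fun p => A p a b)) -> sm i W (fun p => \det (A p)).
Proof.
move=> oW HA; apply: sm_sum => // s.
by apply: sm_mul => //; [exact: sm_cst|apply: sm_prod].
Qed.

(** By Cramer's rule the entries are cofactors divided by the determinant, and both are polynomial
    in the entries of [A]. *)
Lemma sm_invmx n i W (A : M -> 'M[R]_n) (a b : 'I_n) : open W ->
  (forall p, cdom i p -> W p -> A p \in unitmx) ->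
  (forall a b : 'I_n, sm i W (fun p => A p a b)) ->
  sm i W (fun p => invmx (A p) a b).
Proof.
move=> oW uA HA.
apply: (@sm_eq _ _ (fun p => (\det (A p))^-1 * cofactor (A p) b a)) => //.
  by move=> p ip Wp; rewrite /invmx uA// !mxE.
apply: sm_mul => //.
  apply: sm_inv => //; last exact: sm_det.
  by move=> p ip Wp; have := uA p ip Wp; rewrite unitmxE unitfE.
apply: sm_mul => //; first exact: sm_cst.
apply: sm_det => // x y; rewrite [X in sm _ _ X](_ : _ =
  fun p => A p (lift b x) (lift a y))//.
by apply/funext => p; rewrite !mxE.
Qed.

Lemma sm_pd i W a f : open W -> sm i W f -> sm i W (pd i a f).
Proof.
move=> oW Hf k; apply: Ck_eq (Ck_pd_smooth k a Hf); first exact: image_open.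
by move=> _ [p [ip Wp] <-] /=; rewrite /pd cinvK.
Qed.

Lemma sm_ispd i W a f p : sm i W f -> cdom i p -> W p ->
  ispd i a f p (pd i a f p).
Proof.
move=> /(_ 1%N) Hf ip Wp; apply: Ck_pd; first exact: Hf.
by exists p.
Qed.

Lemma ispd_pd i a f p l : ispd i a f p l -> pd i a f p = l.
Proof. exact: partial_val. Qed.

Lemma ispd_eq i a f p l l' : ispd i a f p l -> l = l' -> ispd i a f p l'.
Proof. by move=> ? <-. Qed.

Lemma ispd_cst i a p (c : R) : ispd i a (fun=> c) p 0.
Proof. exact: is_derive_fc. Qed.

Lemma ispdD i a f g p l m : ispd i a f p l -> ispd i a g p m ->
  ispd i a (fun q => f q + g q) p (l + m).
Proof. exact: is_derive_fD. Qed.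

Lemma ispdM i a f g p l m : cdom i p -> ispd i a f p l -> ispd i a g p m ->
  ispd i a (fun q => f q * g q) p (l * g p + f p * m).
Proof.
by move=> ip fl gm; have := is_derive_fM fl gm; rewrite /= cinvK.
Qed.

Lemma ispdZ i a f p (c l : R) : cdom i p -> ispd i a f p l ->
  ispd i a (fun q => c * f q) p (c * l).
Proof.
move=> ip fl; have := ispdM ip (ispd_cst i a p c) fl.
by rewrite mul0r add0r.
Qed.

Lemma ispd_sum (I : Type) (r : seq I) i a (F : I -> M -> R) (D : I -> R) p :
  (forall k, ispd i a (F k) p (D k)) ->
  ispd i a (fun q => \sum_(k <- r) F k q) p (\sum_(k <- r) D k).
Proof. exact: is_derive_fsum. Qed.

Lemma ispd_prod (I : finType) i a (F : I -> M -> R) (D : I -> R) p :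
  cdom i p -> (forall k, ispd i a (F k) p (D k)) ->
  ispd i a (fun q => \prod_k F k q) p
    (\sum_k D k * \prod_(j | j != k) F j p).
Proof.
move=> ip FD; have := is_derive_fprod FD; rewrite /= cinvK//.
Qed.

Lemma ispd_comp1 i a f (phi : R -> R) p l m : cdom i p ->
  ispd i a f p l -> is_derive (f p) (1 : R) phi m ->
  ispd i a (fun q => phi (f q)) p (m * l).
Proof.
by move=> ip fl pm; apply: is_derive_comp1 => //=; rewrite cinvK.
Qed.

(** Identities between components hold on chart domains only, [cinv] being arbitrary elsewhere. A
    derivative sees only the germ at [p], so that is enough. *)
Lemma ispd_near i a W f g p l : open W -> W p -> cdom i p ->
  (forall q, cdom i q -> W q -> f q = g q) ->
  ispd i a f p l -> ispd i a g p l.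
Proof.
move=> oW Wp ip fg; apply: near_eq_is_derive; near=> y.
have [q [iq Wq] <-] : (cmap i @` (cdom i `&` W)) y.
  near: y; apply: open_nbhs_nbhs; split; [exact: image_open|by exists p].
by rewrite /= cinvK// fg.
Unshelve. all: by end_near. Qed.

Lemma sm_jac i j a b : sm i (cdom j) (fun p => jac i j p a b).
Proof.
apply: (@sm_eq _ _ (pd i a (fun q => cmap j q 0 b))); first exact: cdom_open.
  by move=> p _ _; rewrite mxE.
by apply: sm_pd; [exact: cdom_open|exact: transition_smooth].
Qed.

(** Near [p] the function is its expression in the chart [j] composed with the transition map, whose
    partial derivatives form [jac]. *)
Lemma ispd_chain i j a W f p : open W -> sm j W f -> cdom i p -> cdom j p ->
  W p -> ispd i a f p (\sum_b jac i j p a b * pd j b f p).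
Proof.
move=> oW Hf ip jp Wp.
apply: (@ispd_near _ _ (cdom j) (f \o cinv j \o cmap j)) => //.
- exact: cdom_open.
- by move=> q iq jq /=; rewrite cinvK.
have := @is_derive_chain R d d (fun x => cmap j (cinv i x)) (f \o cinv j)
  (cmap i p) (delta_mx 0 a) (fun b => jac i j p a b).
rewrite cinvK//; apply.
- move=> b; rewrite mxE; apply: (@sm_ispd i (cdom j)) => //.
  exact: transition_smooth.
- apply: smooth_on_differentiable Hf _; first exact: image_open.
  by exists p.
Qed.

Lemma pd_chain i j a W f p : open W -> sm j W f -> cdom i p -> cdom j p ->
  W p -> pd i a f p = \sum_b jac i j p a b * pd j b f p.
Proof. by move=> oW Hf ip jp Wp; apply/ispd_pd/(ispd_chain _ oW). Qed.

Lemma sm_continuous i W f p : sm i W f -> cdom i p -> W p ->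
  {for p, continuous f}.
Proof.
move=> Hf ip Wp.
apply: (@near_eq_continuous_at _ _ ((f \o cinv i) \o cmap i)).
  near=> q; rewrite /= cinvK//; near: q; apply: open_nbhs_nbhs; split => //.
  exact: cdom_open.
apply: continuous_comp; first exact: cmap_continuous.
by apply: Ck_cont (Hf 0%N) _; exists p.
Unshelve. all: by end_near. Qed.

End Charts.

(** * Tensor powers *)

Section Tuples.
Variables (R : realType) (d : nat).
Notation idx := (tidx d).

Lemma big_tidx (F : idx -> R) :
  \sum_B F B = F itop + \sum_a F (inl a) + F ibot.
Proof. by rewrite big_sumType/= big_bool/= addrA [F _ + _]addrC. Qed.

Lemma big_tuple0 (I : finType) (F : 0.-tuple I -> R) :
  \sum_B F B = F [tuple].
Proof. by rewrite (big_pred1 [tuple])// => B; exact/esym/eqP/tuple0. Qed.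

Lemma big_tuple_cons (I : finType) k (F : k.+1.-tuple I -> R) :
  \sum_B F B = \sum_b \sum_(A : k.-tuple I) F [tuple of b :: A].
Proof.
rewrite pair_big/= (reindex (fun u : I * k.-tuple I => [tuple of u.1 :: u.2]))//.
exists (fun B => (thead B, [tuple of behead B])) => [[b A] _|B _] /=.
  by rewrite theadE; congr (_, _); apply: val_inj.
by rewrite -tuple_eta.
Qed.

Lemma sum_prod_tuple (I : finType) k (F : 'I_k -> I -> R) :
  \sum_(B : k.-tuple I) \prod_m F m (tnth B m) = \prod_m \sum_b F m b.
Proof.
elim: k F => [|k IH] F; first by rewrite big_tuple0 !big_ord0.
rewrite big_tuple_cons big_ord_recl -IH mulr_suml; apply: eq_bigr => b _.
rewrite mulr_sumr; apply: eq_bigr => A _; rewrite big_ord_recl tnth0.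
by congr (_ * _); apply: eq_bigr => m _; rewrite tnthS.
Qed.

(** The [k]-fold tensor power of [S]. Changes of chart and changes of scale both act on components
    in this way. *)
Definition tact k (S : idx -> idx -> R) (V : tensor R d k) : tensor R d k :=
  fun A => \sum_B (\prod_m S (tnth A m) (tnth B m)) * V B.

(** The infinitesimal counterpart of [tact]: [theta] acts as a derivation, one slot at a time. The
    coupled connection is a partial derivative plus such a term. *)
Definition dact k (theta : idx -> idx -> R) (V : tensor R d k) : tensor R d k :=
  fun A => \sum_m \sum_B theta (tnth A m) B * V (subst_slot A m B).

Lemma tact_comp k (S S' : idx -> idx -> R) (V : tensor R d k) A :
  tact S (tact S' V) A = tact (fun a c => \sum_b S a b * S' b c) V A.
Proof.
rewrite /tact; under eq_bigr do rewrite mulr_sumr.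
rewrite exchange_big/=; apply: eq_bigr => C _.
under eq_bigr do rewrite mulrA -big_split/=.
rewrite -mulr_suml; congr (_ * _).
exact: (sum_prod_tuple (fun m b => S (tnth A m) b * S' b (tnth C m))).
Qed.

Lemma tact1 k (V : tensor R d k) A : tact (fun a b => (a == b)%:R) V A = V A.
Proof.
rewrite /tact (bigD1 A)//= big1 ?mul1r; last by move=> m _; rewrite eqxx.
rewrite big1 ?addr0// => B BA.
have [m Am] : exists m, tnth A m != tnth B m.
  apply/existsP; apply: contraNT BA; rewrite negb_exists => /forallP h.
  by apply/eqP/eq_from_tnth => m; have := h m; rewrite negbK => /eqP.
by rewrite (bigD1 m)//= (negbTE Am) !mul0r.
Qed.

Lemma tnth_subst k (A : k.-tuple idx) m B n :
  tnth (subst_slot A m B) n = if n == m then B else tnth A n.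
Proof. by rewrite tnth_mktuple. Qed.

Lemma subst_substK k (A : k.-tuple idx) m B :
  subst_slot (subst_slot A m B) m (tnth A m) = A.
Proof.
by apply: eq_from_tnth => n; rewrite !tnth_subst; case: eqP => // ->.
Qed.

(** Exchanging the entry in slot [m] with the free index is an involution of the summation range. *)
Lemma big_subst k m (G : k.-tuple idx -> idx -> R) :
  \sum_B \sum_c G B c = \sum_C \sum_b G (subst_slot C m b) (tnth C m).
Proof.
rewrite !pair_big/=.
rewrite (reindex (fun u : k.-tuple idx * idx =>
  (subst_slot u.1 m u.2, tnth u.1 m)))//=.
exists (fun u : k.-tuple idx * idx => (subst_slot u.1 m u.2, tnth u.1 m));
  by move=> [B c] _ /=; rewrite subst_substK tnth_subst eqxx.
Qed.

(* The hypothesis is the transformation law of connection coefficients [th], [th']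
   under the change of frame [S], with [dS] a partial derivative of [S]. *)
Lemma dact_tact k (S dS th th' : idx -> idx -> R) (V : tensor R d k) A :
  (forall B C, dS B C + \sum_E th B E * S E C = \sum_E S B E * th' E C) ->
  \sum_C (\sum_m dS (tnth A m) (tnth C m) *
            \prod_(n | n != m) S (tnth A n) (tnth C n)) * V C
  + dact th (tact S V) A = tact S (dact th' V) A.
Proof.
move=> H.
have -> : dact th (tact S V) A = \sum_C (\sum_m (\sum_E
    th (tnth A m) E * S E (tnth C m)) *
    \prod_(n | n != m) S (tnth A n) (tnth C n)) * V C.
  rewrite /dact /tact.
  under eq_bigr do under eq_bigr do rewrite mulr_sumr.
  under eq_bigr do rewrite exchange_big/=.
  rewrite exchange_big/=; apply: eq_bigr => C _; rewrite mulr_suml.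
  apply: eq_bigr => m _; rewrite !mulr_suml; apply: eq_bigr => E _.
  rewrite (bigD1 m)//= tnth_subst eqxx -!mulrA; do 3 congr (_ * _).
  by apply: eq_bigr => n nm; rewrite tnth_subst (negbTE nm).
rewrite -big_split/=.
have -> : tact S (dact th' V) A = \sum_C (\sum_m (\sum_E
    S (tnth A m) E * th' E (tnth C m)) *
    \prod_(n | n != m) S (tnth A n) (tnth C n)) * V C.
  rewrite /dact /tact; under eq_bigr do rewrite mulr_sumr.
  rewrite exchange_big/=; under [RHS]eq_bigr do rewrite mulr_suml.
  rewrite [RHS]exchange_big/=; apply: eq_bigr => m _.
  under eq_bigr do rewrite mulr_sumr.
  rewrite (big_subst m); apply: eq_bigr => C _.
  rewrite !mulr_suml; apply: eq_bigr => E _.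
  rewrite subst_substK (bigD1 m)//= tnth_subst eqxx !mulrA; congr (_ * _).
  rewrite mulrAC; congr (_ * _ * _).
  by apply: eq_bigr => n nm; rewrite tnth_subst (negbTE nm).
apply: eq_bigr => C _; rewrite -mulrDl -big_split/=; congr (_ * _).
by apply: eq_bigr => m _; rewrite -mulrDl H.
Qed.

Lemma dact_sum k (I : Type) (r : seq I) (c : I -> R) (th : I -> idx -> idx -> R)
    (V : tensor R d k) A :
  dact (fun B C => \sum_(i <- r) c i * th i B C) V A =
  \sum_(i <- r) c i * dact (th i) V A.
Proof.
rewrite /dact; under [RHS]eq_bigr do rewrite mulr_sumr.
rewrite [RHS]exchange_big/=; apply: eq_bigr => m _.
under [RHS]eq_bigr do rewrite mulr_sumr.
rewrite [RHS]exchange_big/=; apply: eq_bigr => B _.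
by rewrite mulr_suml; apply: eq_bigr => i _; rewrite mulrA.
Qed.

Lemma tact_lin k S (x y : R) (V W : tensor R d k) A :
  tact S (fun B => x * V B + y * W B) A = x * tact S V A + y * tact S W A.
Proof.
rewrite /tact !mulr_sumr -big_split/=; apply: eq_bigr => B _.
by rewrite mulrDr !(mulrCA _ (\prod_m _)).
Qed.

Lemma tactD k S (V W : tensor R d k) A :
  tact S (fun B => V B + W B) A = tact S V A + tact S W A.
Proof.
by rewrite /tact -big_split/=; apply: eq_bigr => B _; rewrite mulrDr.
Qed.

Lemma tactZ k S (x : R) (V : tensor R d k) A :
  tact S (fun B => x * V B) A = x * tact S V A.
Proof. by rewrite /tact mulr_sumr; apply: eq_bigr => B _; rewrite mulrCA. Qed.

Lemma tact_sum k (I : Type) (r : seq I) S (F : I -> tensor R d k) A :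
  tact S (fun B => \sum_(i <- r) F i B) A = \sum_(i <- r) tact S (F i) A.
Proof.
by rewrite /tact exchange_big/=; apply: eq_bigr => B _; rewrite mulr_sumr.
Qed.

Lemma tact_cons k S (V : tensor R d k.+1) b (A : k.-tuple idx) :
  tact S V [tuple of b :: A] =
  \sum_b' S b b' * tact S (fun A' => V [tuple of b' :: A']) A.
Proof.
rewrite /tact big_tuple_cons; apply: eq_bigr => b' _.
rewrite mulr_sumr; apply: eq_bigr => A' _.
rewrite big_ord_recl !tnth0 -mulrA; do 2 congr (_ * _).
by apply: eq_bigr => m _; rewrite !tnthS.
Qed.

Lemma op_metric_cons G k (V : tensor R d k) (b c : idx) (A : k.-tuple idx) :
  op_sem G (OpMetric R k) V [tuple of b :: [tuple of c :: A]] =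
  tmetinv G b c * V A.
Proof. by rewrite /=; congr (_ * V _); exact: val_inj. Qed.

(** Slot permutations commute with every [tact]. The two hypotheses, that [S] is an isometry between
    the tractor metrics of [G] and [G'] and likewise for the inverse metrics, settle contraction and
    multiplication by the metric. *)
Lemma tensor_op_tact (G G' : 'M[R]_d) (S : idx -> idx -> R) k l
    (f : tensor_op R k l) (V : tensor R d k) A :
  (forall B' C', \sum_B \sum_C tmet G' B C * (S B B' * S C C') = tmet G B' C') ->
  (forall B' C', tmetinv G' B' C' =
     \sum_B \sum_C S B' B * S C' C * tmetinv G B C) ->
  op_sem G' f (tact S V) A = tact S (op_sem G f V) A.
Proof.
move=> Hm Hi; elim: f V A => {k l} /=.
- move=> k s V A; rewrite /tact.
  rewrite [LHS](reindex (fun B : k.-tuple idx => [tuple tnth B (s m) | m < k])).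
    apply: eq_bigr => B _; congr (_ * _).
    rewrite [RHS](reindex_inj (@perm_inj _ s)); apply: eq_bigr => m _.
    by rewrite !tnth_mktuple.
  exists (fun B : k.-tuple idx => [tuple tnth B (s^-1%g m) | m < k]) => B _;
    by apply: eq_from_tnth => m; rewrite !tnth_mktuple ?permK ?permKV.
- move=> k V A.
  transitivity (\sum_B' \sum_C' \sum_B \sum_C (tmet G' B C * (S B B' * S C C'))
      * tact S (fun A' => V [tuple of B' :: C' :: A']) A).
    under eq_bigr do under eq_bigr do rewrite tact_cons mulr_sumr.
    under eq_bigr do rewrite exchange_big/=.
    rewrite exchange_big/=; apply: eq_bigr => B' _.
    under eq_bigr do under eq_bigr do rewrite tact_cons !mulr_sumr.
    under eq_bigr do rewrite exchange_big/=.
    rewrite exchange_big/=; apply: eq_bigr => C' _.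
    by apply: eq_bigr => B _; apply: eq_bigr => C _; rewrite !mulrA.
  rewrite tact_sum; apply: eq_bigr => B' _.
  rewrite tact_sum; apply: eq_bigr => C' _.
  rewrite tactZ -Hm mulr_suml; apply: eq_bigr => B _.
  by rewrite mulr_suml.
- move=> k V A; case/tupleP: A => b A; case/tupleP: A => c A.
  rewrite !tact_cons [LHS](@op_metric_cons G') Hi mulr_suml.
  apply: eq_bigr => B _; rewrite tact_cons mulr_sumr mulr_suml.
  apply: eq_bigr => C _.
  rewrite (_ : (fun A' => _) = (fun A' => tmetinv G B C * V A')); last first.
    by apply/funext => A'; exact: (@op_metric_cons G).
  by rewrite tactZ !mulrA.
- move=> k l m f1 IH1 f2 IH2 V A.
  have -> : op_sem G' f2 (tact S V) = tact S (op_sem G f2 V).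
    by apply/funext => B; exact: IH2.
  exact: IH1.
- by move=> k l x f1 IH1 y f2 IH2 V A; rewrite IH1 IH2 tact_lin.
Qed.

Lemma op_semZ G k l (f : tensor_op R k l) (x : R) (V : tensor R d k) A :
  op_sem G f (fun B => x * V B) A = x * op_sem G f V A.
Proof.
elim: f V A => {k l} //=.
- move=> k V A; rewrite mulr_sumr; apply: eq_bigr => B _.
  by rewrite mulr_sumr; apply: eq_bigr => C _; rewrite mulrCA.
- by move=> k V A; rewrite mulrCA.
- move=> k l m f1 IH1 f2 IH2 V A; rewrite -IH1; congr op_sem.
  by apply/funext => B; exact: IH2.
- by move=> k l x' f1 IH1 y f2 IH2 V A; rewrite IH1 IH2 mulrDr !(mulrCA x).
Qed.

Lemma op_semD G k l (f : tensor_op R k l) (V W : tensor R d k) A :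
  op_sem G f (fun B => V B + W B) A = op_sem G f V A + op_sem G f W A.
Proof.
elim: f V W A => {k l} //=.
- move=> k V W A; rewrite -big_split; apply: eq_bigr => B _.
  by rewrite -big_split; apply: eq_bigr => C _; rewrite mulrDr.
- by move=> k V W A; rewrite mulrDr.
- move=> k l m f1 IH1 f2 IH2 V W A; rewrite -IH1; congr op_sem.
  by apply/funext => B; exact: IH2.
- by move=> k l x' f1 IH1 y f2 IH2 V W A; rewrite IH1 IH2; ring.
Qed.

Lemma op_sem0 G k l (f : tensor_op R k l) A :
  op_sem (d := d) G f (fun=> 0) A = 0.
Proof.
rewrite -[RHS](mul0r (op_sem G f (fun=> 0) A)) -op_semZ.
by under eq_fun do rewrite -(mul0r 0).
Qed.

Lemma op_sem_sum G k l (f : tensor_op R k l) (I : Type) (r : seq I)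
    (F : I -> tensor R d k) A :
  op_sem G f (fun B => \sum_(i <- r) F i B) A =
  \sum_(i <- r) op_sem G f (F i) A.
Proof.
elim: r => [|i r IH].
  by under eq_fun do rewrite big_nil; rewrite big_nil op_sem0.
by under eq_fun do rewrite big_cons; rewrite big_cons op_semD IH.
Qed.

End Tuples.

(** * The coupled derivative in charts *)

Section Covariance.
Variables (R : realType) (d : nat) (M : manifold R d).
Variables (g : field2 M) (Gam : christoffel M) (P : field2 M).
Hypotheses (hg : is_metric g) (hGam : is_levi_civita g Gam) (hP : is_field2 P).
Implicit Types (i j : chart M) (a b c e : 'I_d) (p : M).
Notation idx := (tidx d).

Lemma field2_chart (T : field2 M) i j p a b : is_field2 T ->
  cdom i p -> cdom j p ->
  T i p a b = \sum_c jac i j p a c * (\sum_e T j p c e * jac i j p b e).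
Proof.
move=> [_ hT] ip jp; rewrite (hT i j p ip jp) -mulmxA !mxE; apply: eq_bigr => c _.
by rewrite !mxE; congr (_ * _); apply: eq_bigr => e _; rewrite !mxE.
Qed.

(** In g_i = J g_j J^T the left side is invertible, hence so is the factor J. *)
Lemma jac_unit i j p : cdom i p -> cdom j p -> jac i j p \in unitmx.
Proof.
move=> ip jp; case: hg => -[_ hT] _ hu; have := hu i p ip.
by rewrite (hT i j p ip jp) !unitmx_mul => /andP[/andP[]].
Qed.

(** Phrased without the inverse of J; [gtrace_chart] uses it to carry traces from one chart to
    another. *)
Lemma ginv_chart i j p : cdom i p -> cdom j p ->
  (jac i j p)^T *m ginv g i p *m jac i j p = ginv g j p.
Proof.
move=> ip jp; have uJ := jac_unit ip jp; case: hg => -[_ hT] _ hu.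
rewrite /ginv (hT i j p ip jp); set J := jac i j p.
have uJT : J^T \in unitmx by rewrite unitmx_tr.
have ug := hu j p jp.
apply: (row_full_inj (A := g j p)); first by rewrite row_full_unit.
rewrite mulmxV//; apply: (row_full_inj (A := J)); first by rewrite row_full_unit.
rewrite mulmx1 !mulmxA mulmxV ?mul1mx// !unitmx_mul uJ uJT.
by rewrite ug.
Qed.

Lemma ginv_chartE i j p c e : cdom i p -> cdom j p ->
  ginv g j p c e =
  \sum_a \sum_b jac i j p a c * (ginv g i p a b * jac i j p b e).
Proof.
move=> ip jp; rewrite -(ginv_chart ip jp) -mulmxA !mxE; apply: eq_bigr => a _.
by rewrite !mxE mulr_sumr.
Qed.

Lemma gtrace_chart i j p (T T' : 'I_d -> 'I_d -> R) : cdom i p -> cdom j p ->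
  (forall a b, T a b = \sum_c \sum_e jac i j p a c * jac i j p b e * T' c e) ->
  gtrace g i T p = gtrace g j T' p.
Proof.
move=> ip jp hT; rewrite /gtrace.
under [RHS]eq_bigr do under eq_bigr do rewrite (ginv_chartE _ _ ip jp) mulr_suml.
under [RHS]eq_bigr do rewrite exchange_big/=.
rewrite [RHS]exchange_big/=; apply: eq_bigr => a _.
under [RHS]eq_bigr do under eq_bigr do rewrite mulr_suml.
under [RHS]eq_bigr do rewrite exchange_big/=.
rewrite [RHS]exchange_big/=; apply: eq_bigr => b _.
rewrite hT mulr_sumr; apply: eq_bigr => c _.
by rewrite mulr_sumr; apply: eq_bigr => e _; ring.
Qed.

Lemma sm_chart_tr i j B C : sm i (cdom j) (fun q => chart_tr i j q B C).
Proof.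
have ? := cdom_open j.
by case: B C => [b|[]] [c|[]] /=; try exact: sm_cst; exact: sm_jac.
Qed.

Lemma pd_cst i a p (x : R) : pd i a (fun=> x) p = 0.
Proof. exact: ispd_pd (ispd_cst _ _ _ _). Qed.

Lemma field2_ginv_chart (T : field2 M) i j p : is_field2 T ->
  cdom i p -> cdom j p ->
  T i p *m ginv g i p *m jac i j p = jac i j p *m (T j p *m ginv g j p).
Proof.
move=> [_ hT] ip jp.
by rewrite (hT i j p ip jp) -(ginv_chart ip jp) !mulmxA.
Qed.

Lemma sum_0l (I : finType) (F : I -> R) : \sum_i 0 * F i = 0.
Proof. by apply: big1 => k _; rewrite mul0r. Qed.

Lemma sum_0r (I : finType) (F : I -> R) : \sum_i F i * 0 = 0.
Proof. by apply: big1 => k _; rewrite mulr0. Qed.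

Lemma sum_delta (I : finType) (k : I) (F : I -> R) :
  \sum_i (k == i)%:R * F i = F k.
Proof.
rewrite (bigD1 k)//= eqxx mul1r big1 ?addr0// => i.
by rewrite eq_sym => /negbTE ->; rewrite mul0r.
Qed.

(** The law of the connection matrix in the form that [dact_tact] expects. Second derivatives of the
    transition map occur only in the block of two covector slots, as the inhomogeneous term of the
    Christoffel symbols; the other blocks express that [P], [g] and the Kronecker delta are
    tensorial. *)
Lemma tcoef_chart i j a p B C : cdom i p -> cdom j p ->
  pd i a (fun q => chart_tr i j q B C) p
    + \sum_E tcoef g Gam P i a B E p * chart_tr i j p E C =
  \sum_E chart_tr i j p B E *
    (\sum_b jac i j p a b * tcoef g Gam P j b E C p).
Proof.
move=> ip jp; rewrite !big_tidx.
case: B C => [b|[]] [c|[]] /=; rewrite ?pd_cst !(mul0r, mul1r, mulr0, mulr1).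
all: rewrite ?(sum_0l, sum_0r, add0r, addr0)//.
- case: hGam => -[_ /(_ i j p a b c ip jp) H] _ _.
  under eq_bigr do rewrite mulNr.
  rewrite sumrN H opprD addrCA subrr addr0 -sumrN.
  under [RHS]eq_bigr do rewrite mulr_sumr.
  rewrite [RHS]exchange_big/=; apply: eq_bigr => c1 _.
  by rewrite -sumrN; apply: eq_bigr => c2 _; ring.
- rewrite (field2_chart a b hP ip jp); under [LHS]eq_bigr do rewrite mulr_sumr.
  under [RHS]eq_bigr do rewrite mulr_sumr.
  rewrite [RHS]exchange_big/=; apply: eq_bigr => c1 _.
  by apply: eq_bigr => c2 _; ring.
- case: hg => hg2 _ _.
  rewrite (field2_chart a b hg2 ip jp); under [LHS]eq_bigr do rewrite mulr_sumr.
  under [RHS]eq_bigr do rewrite mulr_sumr.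
  rewrite [RHS]exchange_big/=; apply: eq_bigr => c1 _.
  by apply: eq_bigr => c2 _; ring.
- under eq_bigr do rewrite mulNr.
  rewrite sumrN sum_delta.
  under eq_bigr do rewrite mulrN mulrC eq_sym.
  by rewrite sumrN sum_delta.
- have /(congr1 (fun A : 'M[R]_d => - A a c)) := field2_ginv_chart hP ip jp.
  rewrite !mxE -!sumrN => e; apply: etrans (etrans e _).
    by apply: eq_bigr => x _; rewrite !mxE mulNr.
  by apply: eq_bigr => x _; rewrite !mxE mulrN.
Qed.

Lemma ispd_tact i j a p k (Vj : k.-tuple idx -> M -> R) A :
  (forall A, smooth_in j (Vj A)) -> cdom i p -> cdom j p ->
  ispd i a (fun q => tact (chart_tr i j q) (fun B => Vj B q) A) p
    (\sum_C (\sum_m pd i a (fun q => chart_tr i j q (tnth A m) (tnth C m)) p *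
        \prod_(n | n != m) chart_tr i j p (tnth A n) (tnth C n)) * Vj C p
     + tact (chart_tr i j p) (fun B => \sum_b jac i j p a b * pd j b (Vj B) p) A).
Proof.
move=> hV ip jp; rewrite /tact -big_split/=.
apply: ispd_sum => C; apply: ispdM => //.
  apply: (ispd_prod (D := fun m => pd i a (fun q =>
    chart_tr i j q (tnth A m) (tnth C m)) p)) => // m.
  by apply: (sm_ispd a (@sm_chart_tr i j _ _)).
by apply: (@ispd_chain _ _ _ _ _ _ setT); [exact: openT|rewrite sm_setT| | |].
Qed.

Lemma tDE k i a (V : k.-tuple idx -> M -> R) A p :
  tD g Gam P i a V A p = pd i a (V A) p +
    dact (fun B C => tcoef g Gam P i a B C p) (fun B => V B p) A.
Proof. by []. Qed.

(** Differentiating [tact] produces derivatives of the frame entries; [dact_tact] absorbs them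
    together with the connection term of chart [i], and what is left is the connection of chart
    [j]. *)
Lemma tD_chart i j a p k (Vi Vj : k.-tuple idx -> M -> R) A :
  (forall A, smooth_in j (Vj A)) -> cdom i p -> cdom j p ->
  (forall A q, cdom i q -> cdom j q ->
     Vi A q = tact (chart_tr i j q) (fun B => Vj B q) A) ->
  tD g Gam P i a Vi A p = \sum_b jac i j p a b *
    tact (chart_tr i j p) (fun B => tD g Gam P j b Vj B p) A.
Proof.
move=> hV ip jp hVV; rewrite tDE.
have /ispd_pd -> := @ispd_near _ _ _ i a (cdom j) _ (Vi A) _ _ (@cdom_open _ _ _ j)
  jp ip (fun q iq jq => esym (hVV A q iq jq)) (ispd_tact a A hV ip jp).
rewrite (_ : (fun B => Vi B p) = tact (chart_tr i j p) (fun B => Vj B p)); last first.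
  by apply/funext => B; exact: hVV.
rewrite addrAC (dact_tact _ _ (fun B C => tcoef_chart a B C ip jp)).
have -> : dact (fun E C => \sum_b jac i j p a b * tcoef g Gam P j b E C p)
    (fun B => Vj B p) = (fun B => \sum_b jac i j p a b *
    dact (fun E C => tcoef g Gam P j b E C p) (fun B => Vj B p) B).
  by apply/funext => B; rewrite dact_sum.
rewrite !tact_sum -big_split/=; apply: eq_bigr => b _.
rewrite !tactZ -mulrDr; congr (_ * _).
by rewrite -tactD; congr (tact _ _ _); apply/funext => B; rewrite tDE addrC.
Qed.

End Covariance.

(** * Second derivatives, Laplacians and scalars across charts *)

Section Operators.
Variables (R : realType) (d : nat) (M : manifold R d).
Variables (g : field2 M) (Gam : christoffel M) (P : field2 M).
Hypotheses (hg : is_metric g) (hGam : is_levi_civita g Gam) (hP : is_field2 P).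
Implicit Types (i j : chart M) (a b c e : 'I_d) (p : M) (W : set M).
Notation idx := (tidx d).

Lemma sm_metric i W a b : sm i W (fun p => g i p a b).
Proof. by case: hg => -[h _] _ _; exact: sm_in. Qed.

Lemma sm_field2 (T : field2 M) i W a b : is_field2 T ->
  sm i W (fun p => T i p a b).
Proof. by case=> h _; exact: sm_in. Qed.

Lemma sm_ginv i W a b : open W -> sm i W (fun p => ginv g i p a b).
Proof.
move=> oW; apply: sm_invmx => //; last by move=> x y; exact: sm_metric.
by case: hg => _ _ h p ip _; exact: h.
Qed.

Lemma sm_tcoef i W a B C : open W -> sm i W (tcoef g Gam P i a B C).
Proof.
move=> oW; case: B C => [b|[]] [c|[]] /=; try exact: sm_cst.
- by apply: sm_opp => //; case: hGam => -[h _] _ _; exact: sm_in.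
- exact: sm_field2.
- exact: sm_metric.
- apply: sm_opp => //; apply: sm_sum => // e.
  by apply: sm_mul => //; [exact: sm_field2|exact: sm_ginv].
Qed.

Lemma sm_tD k i W a (V : k.-tuple idx -> M -> R) A : open W ->
  (forall B, sm i W (V B)) -> sm i W (tD g Gam P i a V A).
Proof.
move=> oW hV; apply: sm_add => //; first exact: sm_pd.
apply: sm_sum => // m; apply: sm_sum => // B.
by apply: sm_mul => //; exact: sm_tcoef.
Qed.

Lemma sm_tD2 k i W a b (V : k.-tuple idx -> M -> R) A : open W ->
  (forall B, sm i W (V B)) -> sm i W (tD2 g Gam P i a b V A).
Proof.
move=> oW hV; apply: sm_sub2 => //.
  by apply: sm_tD => // B; exact: sm_tD.
apply: sm_sum => // c; apply: sm_mul => //; last exact: sm_tD.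
by case: hGam => -[h _] _ _; exact: sm_in.
Qed.

Lemma sm_gtrace i W (T : 'I_d -> 'I_d -> M -> R) : open W ->
  (forall a b, sm i W (T a b)) ->
  sm i W (fun p => gtrace g i (fun a b => T a b p) p).
Proof.
move=> oW hT; apply: sm_sum => // a; apply: sm_sum => // b.
by apply: sm_mul => //; exact: sm_ginv.
Qed.

Lemma dact_lin k (th : idx -> idx -> R) (I : Type) (r : seq I) (x : I -> R)
    (V : I -> tensor R d k) A :
  dact th (fun B => \sum_(c <- r) x c * V c B) A =
  \sum_(c <- r) x c * dact th (V c) A.
Proof.
rewrite /dact; under [RHS]eq_bigr do rewrite mulr_sumr.
rewrite [RHS]exchange_big/=; apply: eq_bigr => m _.
under [RHS]eq_bigr do rewrite mulr_sumr.
rewrite [RHS]exchange_big/=; apply: eq_bigr => B _.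
by rewrite mulr_sumr; apply: eq_bigr => c _; rewrite mulrCA.
Qed.

Lemma tD2_chart i j a b p k (Vi Vj : k.-tuple idx -> M -> R) A :
  (forall A, smooth_in j (Vj A)) -> cdom i p -> cdom j p ->
  (forall A q, cdom i q -> cdom j q ->
     Vi A q = tact (chart_tr i j q) (fun B => Vj B q) A) ->
  tD2 g Gam P i a b Vi A p = \sum_c \sum_e jac i j p a c * jac i j p b e *
    tact (chart_tr i j p) (fun B => tD2 g Gam P j c e Vj B p) A.
Proof.
move=> hV ip jp hVV.
(* A hybrid: the derivative index refers to chart [j], the tractor slots to the frame of chart [i].
   It separates the Jacobian of the derivative index from the frame change of the slots. *)
pose Y c (B : k.-tuple idx) q :=
  tact (chart_tr i j q) (fun B => tD g Gam P j c Vj B q) B.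
have XE c B q : cdom i q -> cdom j q ->
    tD g Gam P i c Vi B q = \sum_e jac i j q c e * Y e B q.
  by move=> iq jq; exact: tD_chart.
have hDV c B : smooth_in j (tD g Gam P j c Vj B).
  by rewrite -sm_setT; apply: sm_tD => [|B']; [exact: openT|rewrite sm_setT].
have hY c B : ispd i a (Y c B) p (pd i a (Y c B) p).
  have h := ispd_tact a B (hDV c) ip jp.
  by apply: (ispd_eq h); rewrite (ispd_pd h).
have DX : tD g Gam P i a (tD g Gam P i b Vi) A p =
    \sum_e (pd i a (fun q => jac i j q b e) p * Y e A p +
      jac i j p b e * tD g Gam P i a (Y e) A p).
  rewrite tDE; have /ispd_pd -> : ispd i a (tD g Gam P i b Vi A) p
      (\sum_e (pd i a (fun q => jac i j q b e) p * Y e A p +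
        jac i j p b e * pd i a (Y e A) p)).
    apply: (@ispd_near _ _ _ i a (cdom j) (fun q => \sum_e jac i j q b e * Y e A q)) => //.
    - exact: cdom_open.
    - by move=> q iq jq; rewrite XE.
    - apply: ispd_sum => e; apply: ispdM => //.
      exact: (sm_ispd a (@sm_jac _ _ _ i j _ _)).
  rewrite (_ : (fun B => tD g Gam P i b Vi B p) =
    (fun B => \sum_e jac i j p b e * Y e B p)); last first.
    by apply/funext => B; exact: XE.
  rewrite dact_lin -big_split/=; apply: eq_bigr => e _.
  by rewrite tDE mulrDr addrA.
have DY e : tD g Gam P i a (Y e) A p = \sum_c jac i j p a c *
    tact (chart_tr i j p) (fun B => tD g Gam P j c (tD g Gam P j e Vj) B p) A.
  exact: tD_chart.
rewrite /tD2 DX.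
under [X in _ - X]eq_bigr do rewrite XE// mulr_sumr.
rewrite [X in _ - X]exchange_big/=.
have -> : \sum_e \sum_c Gam i c a b p * (jac i j p c e * Y e A p) =
   \sum_e (\sum_c1 \sum_c2 Gam j e c1 c2 p * jac i j p a c1 * jac i j p b c2
     + pd i a (fun q => jac i j q b e) p) * Y e A p.
  apply: eq_bigr => e _; case: hGam => -[_ H] _ _.
  by rewrite -H// mulr_suml; apply: eq_bigr => c _; rewrite mulrA.
under [X in _ - X]eq_bigr do rewrite mulrDl addrC.
(* The derivatives of the Jacobian in [DX] cancel against the inhomogeneous term in the law of
   [Gam]. *)
rewrite !big_split/= opprD addrACA subrr add0r.
under [X in X - _]eq_bigr do rewrite DY mulr_sumr.
rewrite [X in X - _]exchange_big/=.
have RE c e : tact (chart_tr i j p) (fun B => tD2 g Gam P j c e Vj B p) A =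
    tact (chart_tr i j p) (fun B => tD g Gam P j c (tD g Gam P j e Vj) B p) A
    - \sum_f Gam j f c e p * Y f A p.
  rewrite -sumrN; under [X in _ + X]eq_bigr do rewrite -mulNr -tactZ.
  rewrite -tact_sum -tactD; congr (tact _ _ _); apply/funext => B.
  by rewrite /tD2 -sumrN; congr (_ + _); apply: eq_bigr => f _; rewrite mulNr.
under [RHS]eq_bigr do under eq_bigr do rewrite RE mulrBr.
under [RHS]eq_bigr do rewrite sumrB.
rewrite sumrB; congr (_ - _).
  by apply: eq_bigr => c _; apply: eq_bigr => e _; ring.
under [RHS]eq_bigr do under eq_bigr do rewrite mulr_sumr.
under [RHS]eq_bigr do rewrite exchange_big/=.
rewrite [RHS]exchange_big/=; apply: eq_bigr => f _.
rewrite mulr_suml; apply: eq_bigr => c _.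
by rewrite mulr_suml; apply: eq_bigr => e _; ring.
Qed.

Definition chart_cov k (V : tfield M k) : Prop := forall i j A p,
  cdom i p -> cdom j p ->
  V i A p = tact (chart_tr i j p) (fun B => V j B p) A.

(** [Jtrace], [rho] and [Isq] are computed chart by chart, so a scalar is encoded as a family of
    functions that agree on overlaps. *)
Definition iscal (f : chart M -> M -> R) : Prop :=
  (forall i, smooth_in i (f i)) /\
  (forall i j p, cdom i p -> cdom j p -> f i p = f j p).

Lemma tact_gtrace i k (S : idx -> idx -> R) p
    (T : 'I_d -> 'I_d -> tensor R d k) A :
  gtrace g i (fun a b => tact S (T a b) A) p =
  tact S (fun B => gtrace g i (fun a b => T a b B) p) A.
Proof.
rewrite /gtrace tact_sum; apply: eq_bigr => a _.
by rewrite tact_sum; apply: eq_bigr => b _; rewrite tactZ.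
Qed.

Lemma tlap_chart i j p k (V : tfield M k) A :
  (forall i A, smooth_in i (V i A)) -> chart_cov V -> cdom i p -> cdom j p ->
  tlap g Gam P i (V i) A p =
  tact (chart_tr i j p) (fun B => tlap g Gam P j (V j) B p) A.
Proof.
move=> hV hc ip jp; rewrite /tlap -tact_gtrace; apply: gtrace_chart => // a b.
by apply: tD2_chart => // B q iq jq; exact: hc.
Qed.

(** A function is a tractor of rank 0; invariance of [lap], hence of [rho], is thereby a case of
    [tlap_chart]. *)
Lemma lap_tlap i (f : M -> R) p :
  lap g Gam i f p = tlap g Gam P i (fun _ : 0.-tuple idx => f) [tuple] p.
Proof.
have E a (h : M -> R) B : tD g Gam P i a (fun _ : 0.-tuple idx => h) B = pd i a h.
  by apply/funext => q; rewrite /tD big_ord0 addr0.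
have E2 b : tD g Gam P i b (fun _ : 0.-tuple idx => f) = (fun=> pd i b f).
  by apply/funext => B; exact: E.
rewrite /tlap /lap /gtrace; apply: eq_bigr => a _; apply: eq_bigr => b _.
rewrite /tD2 E2 E; congr (_ * (_ - _)); apply: eq_bigr => c _.
by rewrite E.
Qed.

Lemma tact_0 (S : idx -> idx -> R) (V : tensor R d 0) A : tact S V A = V A.
Proof. by rewrite /tact big_tuple0 big_ord0 mul1r (tuple0 A). Qed.

End Operators.

(** * The tractor metric is parallel *)

Section Parallel.
Variables (R : realType) (d : nat) (M : manifold R d).
Variables (g : field2 M) (Gam : christoffel M) (P : field2 M).
Hypotheses (hg : is_metric g) (hGam : is_levi_civita g Gam) (hP : is_field2 P).
Implicit Types (i j : chart M) (a b c e : 'I_d) (p : M) (W : set M).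
Notation idx := (tidx d).

Lemma ginv_sym i p a b : cdom i p -> ginv g i p a b = ginv g i p b a.
Proof.
move=> ip; case: hg => _ hs _.
by rewrite /ginv -[X in _ = invmx X _ _](hs i p ip) -trmx_inv mxE.
Qed.

(** Differentiate the product of g with its inverse and insert metric compatibility of [Gam]. *)
Lemma pd_ginv i a p b c : cdom i p ->
  pd i a (fun q => ginv g i q b c) p =
  - \sum_e (ginv g i p b e * Gam i c a e p + Gam i b a e p * ginv g i p e c).
Proof.
move=> ip; case: (hg) => _ _ hu.
have hsg x y := sm_metric hg i setT x y.
have hsi x y := @sm_ginv _ _ _ _ hg i setT x y openT.
pose N : 'M[R]_d := \matrix_(x, y) Gam i y a x p.
pose D : 'M[R]_d := \matrix_(x, y) pd i a (fun q => ginv g i q x y) p.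
pose dg : 'M[R]_d := \matrix_(x, y) pd i a (fun q => g i q x y) p.
have Edg : dg = N *m g i p + g i p *m N^T.
  apply/matrixP => x y; rewrite !mxE; case: hGam => _ _ /(_ i p a x y ip) ->.
  by rewrite big_split; congr (_ + _); apply: eq_bigr => e _; rewrite !mxE// mulrC.
have E0 : dg *m ginv g i p + g i p *m D = 0.
  apply/matrixP => x y; rewrite !mxE -big_split/=.
  have h : ispd i a (fun q => \sum_e g i q x e * ginv g i q e y) p
    (\sum_e (dg x e * ginv g i p e y + g i p x e * D e y)).
    by apply: ispd_sum => e; rewrite !mxE; apply: ispdM => //;
      [exact: (sm_ispd a (hsg _ _))|exact: (sm_ispd a (hsi _ _))].
  rewrite -(ispd_pd h); apply: ispd_pd.
  apply: (@ispd_near _ _ _ i a setT (fun=> (x == y)%:R)) => //.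
  - exact: openT.
  - move=> q iq _; have /matrixP/(_ x y) := mulmxV (hu i q iq).
    by rewrite !mxE => <-.
  - exact: ispd_cst.
have ED : D = - (ginv g i p *m N + N^T *m ginv g i p).
  have -> : D = - (ginv g i p *m (dg *m ginv g i p)).
    apply/eqP; rewrite -addr_eq0 addrC; apply/eqP.
    rewrite -[X in _ + X](mulKmx (hu i p ip)) -[invmx _]/(ginv g i p).
    by rewrite -mulmxDr E0 mulmx0.
  rewrite Edg mulmxDl mulmxDr !mulmxA mulVmx ?hu// mul1mx.
  by rewrite -(mulmxA (_ *m N)) mulmxV ?hu// mulmx1.
have /matrixP/(_ b c) := ED; rewrite !mxE => ->; congr (- _).
by rewrite big_split; congr (_ + _); apply: eq_bigr => e _; rewrite !mxE.
Qed.

Lemma sm_tmet i W B C : open W -> sm i W (fun q => tmet (g i q) B C).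
Proof.
move=> oW; case: B C => [b|[]] [c|[]] /=; try exact: sm_cst.
exact: sm_ginv.
Qed.

Lemma sm_tmetinv i W B C : open W -> sm i W (fun q => tmetinv (g i q) B C).
Proof.
move=> oW; case: B C => [b|[]] [c|[]] /=; try exact: sm_cst.
exact: sm_metric.
Qed.

Lemma sum_deltar (I : finType) (k : I) (F : I -> R) :
  \sum_i F i * (k == i)%:R = F k.
Proof. by under eq_bigr do rewrite mulrC; exact: sum_delta. Qed.

Lemma ginv_mul i p a b : cdom i p ->
  \sum_e ginv g i p a e * g i p e b = (a == b)%:R.
Proof.
move=> ip; have hu : g i p \in unitmx by case: hg => _ _ /(_ i p ip).
by have /matrixP/(_ a b) := mulVmx hu; rewrite !mxE.
Qed.

(** Parallelism of the tractor metric. The block of two covector slots is metric compatibility; in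
    the mixed blocks a [P] term cancels its copy with raised index, and a Kronecker delta cancels g
    times its inverse. *)
Lemma pd_tmet i a p B C : cdom i p ->
  pd i a (fun q => tmet (g i q) B C) p =
  \sum_E (tmet (g i p) E C * tcoef g Gam P i a E B p
          + tmet (g i p) B E * tcoef g Gam P i a E C p).
Proof.
move=> ip; have hu : g i p \in unitmx by case: hg => _ _ /(_ i p ip).
have hs x y : g i p x y = g i p y x.
  by case: hg => _ /(_ i p ip)/matrixP/(_ x y) + _; rewrite mxE => ->.
rewrite big_tidx.
case: B C => [b|[]] [c|[]] /=; rewrite ?pd_cst !(mul0r, mul1r, mulr0, mulr1).
all: rewrite ?(add0r, addr0).
- rewrite pd_ginv// -sumrN; apply: eq_bigr => e _; rewrite /ginv; ring.
- under eq_bigr do rewrite mul0r add0r mulrC [invmx _ _ _](ginv_sym b _ ip).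
  by rewrite subrr.
- under eq_bigr do rewrite mul0r add0r hs.
  by rewrite (ginv_mul b a ip) eq_sym addrC subrr.
- under eq_bigr do rewrite mul0r addr0 mulrC.
  by rewrite subrr.
- by rewrite big1// => e _; rewrite !mul0r addr0.
- by rewrite big1// => e _; rewrite !mul0r addr0.
- under eq_bigr do rewrite mul0r addr0 [invmx _ _ _](ginv_sym _ c ip) hs.
  by rewrite (ginv_mul c a ip) eq_sym addrC subrr.
- by rewrite big1// => e _; rewrite !mul0r addr0.
- by rewrite big1// => e _; rewrite !mul0r addr0.
Qed.

Lemma pd_tmetinv i a p B C : cdom i p ->
  pd i a (fun q => tmetinv (g i q) B C) p =
  - \sum_E (tcoef g Gam P i a B E p * tmetinv (g i p) E C
            + tcoef g Gam P i a C E p * tmetinv (g i p) B E).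
Proof.
move=> ip.
have hs x y : g i p x y = g i p y x.
  by case: hg => _ /(_ i p ip)/matrixP/(_ x y) + _; rewrite mxE => ->.
have hP0 x : \sum_e (\sum_b P i p a b * ginv g i p b e) * g i p e x =
    P i p a x.
  under eq_bigr do rewrite mulr_suml.
  rewrite exchange_big/=; under eq_bigr do under eq_bigr do rewrite -mulrA.
  under eq_bigr do rewrite -mulr_sumr (ginv_mul _ _ ip).
  by under eq_bigr do rewrite eq_sym; rewrite sum_deltar.
rewrite big_tidx.
case: B C => [b|[]] [c|[]] /=; rewrite ?pd_cst !(mul0r, mul1r, mulr0, mulr1).
all: rewrite ?(add0r, addr0).
- case: hGam => _ _ /(_ i p a b c ip) ->.
  by rewrite -sumrN; apply: eq_bigr => e _; ring.
- under eq_bigr do rewrite mulr0 add0r mulNr hs.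
  by rewrite sumrN sum_delta addNr oppr0.
- under eq_bigr do rewrite mulr0 add0r mulNr hs.
  by rewrite sumrN hP0 subrr oppr0.
- under eq_bigr do rewrite mulr0 addr0 mulNr.
  by rewrite sumrN sum_delta addNr oppr0.
- by rewrite big1 ?oppr0// => e _; rewrite !mulr0 addr0.
- by rewrite big1 ?oppr0// => e _; rewrite !mulr0 addr0.
- under eq_bigr do rewrite mulr0 addr0 mulNr.
  by rewrite sumrN hP0 subrr oppr0.
- by rewrite big1 ?oppr0// => e _; rewrite !mulr0 addr0.
- by rewrite big1 ?oppr0// => e _; rewrite !mulr0 addr0.
Qed.

Definition opf i k l (f : tensor_op R k l) (V : k.-tuple idx -> M -> R) :
    l.-tuple idx -> M -> R :=
  fun B q => op_sem (g i q) f (fun C => V C q) B.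

Lemma sm_opf i W k l (f : tensor_op R k l) (V : k.-tuple idx -> M -> R) B :
  open W -> (forall C, sm i W (V C)) -> sm i W (opf i f V B).
Proof.
move=> oW; elim: f V B => {k l} /=.
- by move=> k s V B hV; exact: hV.
- move=> k V B hV; apply: sm_sum => // E; apply: sm_sum => // F.
  by apply: sm_mul => //; exact: sm_tmet.
- move=> k V B hV; apply: sm_mul => //; exact: sm_tmetinv.
- move=> k l m f1 IH1 f2 IH2 V B hV.
  by apply: (IH1 (opf i f2 V)) => C; exact: IH2.
- move=> k l x f1 IH1 y f2 IH2 V B hV.
  by apply: sm_add => //; apply: sm_mul; rewrite //;
    [exact: sm_cst|exact: IH1|exact: sm_cst|exact: IH2].
Qed.

Lemma subst_cons0 k (A : k.-tuple idx) (b E : idx) :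
  subst_slot [tuple of b :: A] ord0 E = [tuple of E :: A].
Proof.
apply: eq_from_tnth => n; rewrite tnth_subst.
by have [m ->|->] := unliftP ord0 n; rewrite ?tnthS ?tnth0.
Qed.

Lemma subst_consS k (A : k.-tuple idx) (b : idx) m (E : idx) :
  subst_slot [tuple of b :: A] (lift ord0 m) E = [tuple of b :: subst_slot A m E].
Proof.
apply: eq_from_tnth => n; rewrite tnth_subst.
have [n' ->|->] := unliftP ord0 n; rewrite ?tnthS ?tnth0//.
by rewrite (inj_eq lift_inj) tnth_subst.
Qed.

Lemma dact_cons k th (V : tensor R d k.+1) (b : idx) (A : k.-tuple idx) :
  dact th V [tuple of b :: A] = \sum_E th b E * V [tuple of E :: A] +
  dact th (fun A' => V [tuple of b :: A']) A.
Proof.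
rewrite /dact big_ord_recl; congr (_ + _).
  by apply: eq_bigr => E _; rewrite tnth0 subst_cons0.
apply: eq_bigr => m _; apply: eq_bigr => E _.
by rewrite tnthS subst_consS.
Qed.

(** For a parallel [h] the derivative of [h] can be traded for connection terms on the two
    contracted slots, exactly the terms that [dact] produces there. *)
Lemma contract_leibniz (h dh th v : idx -> idx -> R) :
  (forall B C, dh B C = \sum_E (h E C * th E B + h B E * th E C)) ->
  \sum_B \sum_C dh B C * v B C =
  \sum_B \sum_C h B C * (\sum_E th B E * v E C) +
  \sum_B \sum_C h B C * (\sum_E th C E * v B E).
Proof.
move=> H; under eq_bigr do under eq_bigr do rewrite H big_split mulrDl/=.
under eq_bigr do rewrite big_split/=; rewrite big_split/=; congr (_ + _).
  under [RHS]eq_bigr do under eq_bigr do rewrite mulr_sumr.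
  under [RHS]eq_bigr do rewrite exchange_big/=.
  rewrite [RHS]exchange_big/=; apply: eq_bigr => B _.
  rewrite [RHS]exchange_big/=; apply: eq_bigr => C _.
  by rewrite mulr_suml; apply: eq_bigr => E _; rewrite mulrA.
apply: eq_bigr => B _; under [RHS]eq_bigr do rewrite mulr_sumr.
rewrite [RHS]exchange_big/=; apply: eq_bigr => C _.
by rewrite mulr_suml; apply: eq_bigr => E _; rewrite mulrA.
Qed.

(** The cases with content are contraction and multiplication by the metric, settled by [pd_tmet]
    and [pd_tmetinv]. A composition also needs the inner result to be smooth, hence [sm_opf]. *)
Lemma opf_tD i W a p k l (f : tensor_op R k l) (V : k.-tuple idx -> M -> R) A :
  open W -> (forall C, sm i W (V C)) -> cdom i p -> W p ->
  tD g Gam P i a (opf i f V) A p =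
  op_sem (g i p) f (fun B => tD g Gam P i a V B p) A.
Proof.
move=> oW + ip Wp; elim: f V A => {k l}.
- move=> k s V A hV; rewrite /tD/=; congr (_ + _).
  rewrite (reindex_inj (@perm_inj _ s)); apply: eq_bigr => m _.
  apply: eq_bigr => B _; rewrite tnth_mktuple; congr (_ * V _ p).
  apply: eq_from_tnth => n; rewrite tnth_subst !tnth_mktuple.
  by rewrite (inj_eq perm_inj).
- move=> k V A hV; rewrite tDE.
  have /ispd_pd -> : ispd i a (opf i (OpContract R k) V A) p
    (\sum_B \sum_C (pd i a (fun q => tmet (g i q) B C) p * V [tuple of B :: C :: A] p
      + tmet (g i p) B C * pd i a (V [tuple of B :: C :: A]) p)).
    apply: ispd_sum => B; apply: ispd_sum => C; apply: ispdM => //.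
      apply: sm_ispd Wp => //; exact: sm_tmet.
    exact: sm_ispd Wp.
  have E1 : dact (fun B C => tcoef g Gam P i a B C p)
      (fun B => opf i (OpContract R k) V B p) A = \sum_B \sum_C
      tmet (g i p) B C * dact (fun B C => tcoef g Gam P i a B C p)
        (fun A' => V [tuple of B :: [tuple of C :: A']] p) A.
    rewrite [LHS]/dact /opf/=.
    under eq_bigr do under eq_bigr do rewrite mulr_sumr.
    under eq_bigr do rewrite exchange_big/=.
    rewrite exchange_big/=; apply: eq_bigr => B _.
    under eq_bigr do under eq_bigr do rewrite mulr_sumr.
    under eq_bigr do rewrite exchange_big/=.
    rewrite exchange_big/=; apply: eq_bigr => C _.
    rewrite /dact mulr_sumr; apply: eq_bigr => m _.
    by rewrite mulr_sumr; apply: eq_bigr => E _; rewrite mulrCA.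
  have L := contract_leibniz
    (fun B C => V [tuple of B :: [tuple of C :: A]] p)
    (fun B C => pd_tmet a B C ip).
  rewrite E1 /=; under [RHS]eq_bigr do under eq_bigr do
    rewrite tDE mulrDr addrC dact_cons dact_cons !mulrDr.
  under eq_bigr do rewrite big_split/=.
  under [RHS]eq_bigr do rewrite !big_split/=.
  rewrite !big_split/= L; ring.
- move=> k V A hV; case/tupleP: A => b A; case/tupleP: A => c A.
  rewrite [RHS](@op_metric_cons R d (g i p)) !tDE dact_cons dact_cons.
  have E1 (b' c' : idx) (A' : k.-tuple idx) q : opf i (OpMetric R k) V
      [tuple of b' :: [tuple of c' :: A']] q = tmetinv (g i q) b' c' * V A' q.
    exact: (@op_metric_cons R d (g i q)).
  have /ispd_pd -> : ispd i a (opf i (OpMetric R k) V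
      [tuple of b :: [tuple of c :: A]]) p
    (pd i a (fun q => tmetinv (g i q) b c) p * V A p +
     tmetinv (g i p) b c * pd i a (V A) p).
    apply: (@ispd_near _ _ _ i a W (fun q => tmetinv (g i q) b c * V A q)) => //.
    apply: ispdM => //; last exact: sm_ispd Wp.
    by apply: sm_ispd Wp => //; exact: sm_tmetinv.
  rewrite [X in _ + (X + _) = _](eq_bigr (fun E =>
    tcoef g Gam P i a b E p * tmetinv (g i p) E c * V A p)); last first.
    by move=> E _; rewrite -mulrA; congr (_ * _); exact: E1.
  rewrite [X in _ + (_ + (X + _)) = _](eq_bigr (fun E =>
    tcoef g Gam P i a c E p * tmetinv (g i p) b E * V A p)); last first.
    by move=> E _; rewrite -mulrA; congr (_ * _); exact: E1.
  rewrite pd_tmetinv// [X in - X]big_split/= mulNr mulrDl !mulr_suml.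
  have -> : dact (fun B C => tcoef g Gam P i a B C p)
     (fun A' => opf i (OpMetric R k) V [tuple of b :: [tuple of c :: A']] p) A =
     tmetinv (g i p) b c * dact (fun B C => tcoef g Gam P i a B C p)
     (fun A' => V A' p) A.
    rewrite /dact mulr_sumr; apply: eq_bigr => m _.
    by rewrite mulr_sumr; apply: eq_bigr => E _; rewrite E1 mulrCA.
  ring.
- move=> k l m f1 IH1 f2 IH2 V A hV.
  rewrite [LHS](IH1 (opf i f2 V)); last by move=> C; exact: sm_opf.
  by rewrite /=; congr op_sem; apply/funext => B; exact: IH2.
- move=> k l x f1 IH1 y f2 IH2 V A hV; rewrite /= -IH1// -IH2// !tDE.
  have h1 := sm_ispd a (sm_opf f1 A oW hV) ip Wp.
  have h2 := sm_ispd a (sm_opf f2 A oW hV) ip Wp.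
  have /ispd_pd -> : ispd i a (opf i (OpLin x f1 y f2) V A) p
    (x * pd i a (opf i f1 V A) p + y * pd i a (opf i f2 V A) p).
    by apply: ispdD; apply: ispdZ.
  have -> : dact (fun B C => tcoef g Gam P i a B C p)
     (fun B => opf i (OpLin x f1 y f2) V B p) A =
    x * dact (fun B C => tcoef g Gam P i a B C p) (fun B => opf i f1 V B p) A +
    y * dact (fun B C => tcoef g Gam P i a B C p) (fun B => opf i f2 V B p) A.
    rewrite /dact !mulr_sumr -big_split/=; apply: eq_bigr => m _.
    rewrite !mulr_sumr -big_split/=; apply: eq_bigr => E _.
    by rewrite /opf/=; ring.
  ring.
Qed.

End Parallel.

(** * Sections in a fixed scale *)

Section Sections.
Variables (R : realType) (d : nat) (M : manifold R d).
Variables (g : field2 M) (Gam : christoffel M) (P : field2 M) (s : M -> R).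
Hypotheses (hg : is_metric g) (hGam : is_levi_civita g Gam) (hP : is_field2 P).
Hypothesis hs : smooth_fun s.
Implicit Types (i j : chart M) (a b c e : 'I_d) (p : M) (W : set M).
Notation idx := (tidx d).

Lemma iscal_cst (x : R) : iscal (fun (_ : chart M) (_ : M) => x).
Proof. by split=> // i; rewrite -sm_setT; apply: sm_cst; exact: openT. Qed.

Lemma iscal_fun (f : M -> R) : smooth_fun f -> iscal (fun _ : chart M => f).
Proof. by []. Qed.

Lemma iscalD (f h : chart M -> M -> R) : iscal f -> iscal h ->
  iscal (fun i p => f i p + h i p).
Proof.
move=> [f1 f2] [h1 h2]; split=> [i|i j p ip jp].
  by rewrite -sm_setT; apply: sm_add; rewrite ?sm_setT//; exact: openT.
by rewrite (f2 i j)// (h2 i j).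
Qed.

Lemma iscalM (f h : chart M -> M -> R) : iscal f -> iscal h ->
  iscal (fun i p => f i p * h i p).
Proof.
move=> [f1 f2] [h1 h2]; split=> [i|i j p ip jp].
  by rewrite -sm_setT; apply: sm_mul; rewrite ?sm_setT//; exact: openT.
by rewrite (f2 i j)// (h2 i j).
Qed.

Lemma iscalN (f : chart M -> M -> R) : iscal f -> iscal (fun i p => - f i p).
Proof.
move=> hf; rewrite (_ : (fun _ _ => _) = (fun i p => -1 * f i p)); last first.
  by apply/funext => i; apply/funext => p; rewrite mulN1r.
by apply: iscalM => //; exact: iscal_cst.
Qed.

Lemma iscalV (f : chart M -> M -> R) : (forall i p, cdom i p -> f i p != 0) ->
  iscal f -> iscal (fun i p => (f i p)^-1).
Proof.
move=> f0 [f1 f2]; split=> [i|i j p ip jp]; last by rewrite (f2 i j).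
rewrite -sm_setT; apply: sm_inv; rewrite ?sm_setT//; first exact: openT.
by move=> p ip _; exact: f0.
Qed.

Lemma iscal_Jtrace : iscal (Jtrace g P).
Proof.
split=> [i|i j p ip jp].
  rewrite -sm_setT; apply: sm_gtrace => //; first exact: openT.
  by move=> a b; exact: sm_field2.
apply: (gtrace_chart hg ip jp) => a b; rewrite (field2_chart a b hP ip jp).
apply: eq_bigr => c _; rewrite mulr_sumr; apply: eq_bigr => e _; ring.
Qed.

Lemma iscal_lap : iscal (fun i => lap g Gam i s).
Proof.
pose S : tfield M 0 := fun _ _ => s.
have hS i A : smooth_in i (S i A) by exact: hs.
split=> [i|i j p ip jp].
  rewrite -sm_setT (_ : lap g Gam i s = fun p =>
      tlap g Gam P i (fun _ : 0.-tuple idx => s) [tuple] p); last first.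
    by apply/funext => p; exact: lap_tlap.
  apply: sm_gtrace => //; first exact: openT.
  move=> a b; apply: sm_tD2 => //; first exact: openT.
  by move=> B; rewrite sm_setT.
rewrite !(lap_tlap g Gam P) (@tlap_chart _ _ _ _ _ _ hg hGam hP i j p 0 S)//.
  by rewrite tact_0.
by move=> i' j' A q _ _; rewrite tact_0.
Qed.

Lemma iscal_rho : iscal (rho g Gam P s).
Proof.
apply: iscalM; first exact: iscal_cst.
apply: iscalD; first exact: iscal_lap.
by apply: iscalM; [exact: iscal_Jtrace|exact: iscal_fun].
Qed.

Lemma sm_nu i W a : open W -> sm i W (nu s i a).
Proof. by move=> oW; apply: sm_pd => //; apply: sm_in; exact: hs. Qed.

Lemma nu_chart i j a p : cdom i p -> cdom j p ->
  nu s i a p = \sum_c jac i j p a c * nu s j c p.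
Proof.
move=> ip jp; apply: (@pd_chain _ _ _ i j a setT); rewrite ?sm_setT//.
exact: openT.
Qed.

Lemma iscal_Isq : iscal (Isq g Gam P s).
Proof.
apply: iscalD.
  split=> [i|i j p ip jp].
    rewrite -sm_setT; apply: sm_gtrace => //; first exact: openT.
    by move=> a b; apply: sm_mul; [exact: openT|apply: sm_nu; exact: openT..].
  apply: (gtrace_chart hg ip jp) => a b; rewrite !(nu_chart _ ip jp) mulr_suml.
  apply: eq_bigr => c _; rewrite mulr_sumr; apply: eq_bigr => e _; ring.
apply: iscalM; last exact: iscal_rho.
by apply: iscalM; [exact: iscal_cst|exact: iscal_fun].
Qed.

Variable Phi : bundle R.
Implicit Types V U : tfield M (rank Phi).

(* No weight: it only shows under a change of scale. *)
Definition gsec V : Prop :=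
  [/\ forall i A, smooth_in i (V i A), chart_cov V &
      forall i p A, cdom i p ->
        op_sem (g i p) (constraint Phi) (fun B => V i B p) A = 0].

Lemma gsecD V U : gsec V -> gsec U -> gsec (fun i A p => V i A p + U i A p).
Proof.
move=> [v1 v2 v3] [u1 u2 u3]; split.
- by move=> i A; rewrite -sm_setT; apply: sm_add; rewrite ?sm_setT//; exact: openT.
- by move=> i j A p ip jp; rewrite tactD (v2 i j)// (u2 i j).
- by move=> i p A ip; rewrite op_semD v3// u3// addr0.
Qed.

Lemma gsecZ f V : iscal f -> gsec V -> gsec (fun i A p => f i p * V i A p).
Proof.
move=> [f1 f2] [v1 v2 v3]; split.
- by move=> i A; rewrite -sm_setT; apply: sm_mul; rewrite ?sm_setT//; exact: openT.
- by move=> i j A p ip jp; rewrite tactZ (v2 i j)// (f2 i j).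
- by move=> i p A ip; rewrite op_semZ v3// mulr0.
Qed.

Lemma gsecN V : gsec V -> gsec (fun i A p => - V i A p).
Proof.
move=> hV; rewrite (_ : (fun _ _ _ => _) = (fun i A p => -1 * V i A p)).
  exact: (gsecZ (iscal_cst (-1))).
by apply/funext => i; apply/funext => A; apply/funext => p; rewrite mulN1r.
Qed.

Lemma tD_zero k i a (Z : k.-tuple idx -> M -> R) A p :
  (forall B q, cdom i q -> Z B q = 0) -> cdom i p ->
  tD g Gam P i a Z A p = 0.
Proof.
move=> hZ ip; rewrite /tD big1 ?addr0.
  apply: ispd_pd; apply: (@ispd_near _ _ _ i a setT (fun=> 0)) => //.
  - exact: openT.
  - by move=> q iq _; rewrite hZ.
  - exact: ispd_cst.
by move=> m _; apply: big1 => B _; rewrite hZ// mulr0.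
Qed.

(** The constraint says that [opf] of the section vanishes on the whole chart domain. Its derivative
    is then zero, and by [opf_tD] this is the constraint on the derivative. *)
Lemma constraint_tD k l (f : tensor_op R k l) i a (V : k.-tuple idx -> M -> R) p A :
  (forall B, smooth_in i (V B)) ->
  (forall q B, cdom i q -> op_sem (g i q) f (fun C => V C q) B = 0) ->
  cdom i p -> op_sem (g i p) f (fun B => tD g Gam P i a V B p) A = 0.
Proof.
move=> hV h0 ip.
rewrite -(@opf_tD _ _ _ _ _ P hg hGam i setT)//; first last.
- by move=> C; rewrite sm_setT.
- exact: openT.
by apply: tD_zero => // B q iq; exact: h0.
Qed.

Lemma constraint_tD2 k l (f : tensor_op R k l) i a b
    (V : k.-tuple idx -> M -> R) p A :
  (forall B, smooth_in i (V B)) ->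
  (forall q B, cdom i q -> op_sem (g i q) f (fun C => V C q) B = 0) ->
  cdom i p -> op_sem (g i p) f (fun B => tD2 g Gam P i a b V B p) A = 0.
Proof.
move=> hV h0 ip; rewrite /tD2.
under [X in op_sem _ _ X]eq_fun do rewrite -mulN1r.
rewrite op_semD op_semZ op_sem_sum constraint_tD//.
- rewrite big1 ?mulr0 ?addr0// => c _.
  by rewrite op_semZ constraint_tD ?mulr0.
- move=> B; rewrite -sm_setT; apply: sm_tD => //; first exact: openT.
  by move=> C; rewrite sm_setT.
- by move=> q B iq; exact: constraint_tD.
Qed.

Lemma op_sem_gtrace i p k l (f : tensor_op R k l) (T : 'I_d -> 'I_d -> tensor R d k) A :
  op_sem (g i p) f (fun B => gtrace g i (fun a b => T a b B) p) A =
  gtrace g i (fun a b => op_sem (g i p) f (T a b) A) p.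
Proof.
rewrite /gtrace op_sem_sum; apply: eq_bigr => a _.
by rewrite op_sem_sum; apply: eq_bigr => b _; rewrite op_semZ.
Qed.

Lemma gtrace0 i p (T : 'I_d -> 'I_d -> R) : (forall a b, T a b = 0) ->
  gtrace g i T p = 0.
Proof.
by move=> h; apply: big1 => a _; apply: big1 => b _; rewrite h mulr0.
Qed.

Lemma gsec_tlap V : gsec V -> gsec (fun i A p => tlap g Gam P i (V i) A p).
Proof.
move=> [v1 v2 v3]; split.
- move=> i A; rewrite -sm_setT; apply: sm_gtrace => //; first exact: openT.
  move=> a b; apply: sm_tD2 => //; first exact: openT.
  by move=> B; rewrite sm_setT.
- by move=> i j A p ip jp; exact: tlap_chart.
- move=> i p A ip; rewrite /tlap op_sem_gtrace; apply: gtrace0 => a b.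
  by apply: constraint_tD2 => // q B; exact: v3.
Qed.

Definition grad i (V : (rank Phi).-tuple idx -> M -> R) A p : R :=
  gtrace g i (fun a b => nu s i a p * tD g Gam P i b V A p) p.

Lemma gsec_grad V : gsec V -> gsec (fun i A p => grad i (V i) A p).
Proof.
move=> [v1 v2 v3]; split.
- move=> i A; rewrite -sm_setT; apply: sm_gtrace => //; first exact: openT.
  move=> a b; apply: sm_mul; first exact: openT.
    by apply: sm_nu; exact: openT.
  apply: sm_tD => //; first exact: openT.
  by move=> B; rewrite sm_setT.
- move=> i j A p ip jp; rewrite /grad -tact_gtrace.
  apply: (gtrace_chart hg ip jp) => a b.
  rewrite (nu_chart _ ip jp) (@tD_chart _ _ _ _ _ _ hg hGam hP i j b p _ (V i) (V j))//.
    rewrite mulr_suml; apply: eq_bigr => c _; rewrite mulr_sumr.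
    by apply: eq_bigr => e _; rewrite tactZ; ring.
  by move=> B q iq jq; exact: v2.
- move=> i p A ip; rewrite /grad op_sem_gtrace; apply: gtrace0 => a b.
  rewrite op_semZ constraint_tD ?mulr0// => q B; exact: v3.
Qed.

Hypothesis hI : forall i p, cdom i p -> Isq g Gam P s i p != 0.

Lemma gsec_IdotD w V : gsec V -> gsec (IdotD g Gam P s w V).
Proof.
move=> hV; apply: gsecD.
  apply: (gsecZ (iscal_cst _)); apply: gsecD; first exact: gsec_grad.
  by apply: gsecZ => //; apply: iscalM; [exact: iscal_cst|exact: iscal_rho].
apply: gsecN; apply: (gsecZ (iscal_fun hs)); apply: gsecD.
  exact: gsec_tlap.
by apply: gsecZ => //; apply: iscalM; [exact: iscal_Jtrace|exact: iscal_cst].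
Qed.

Lemma gsec_opy w V : gsec V -> gsec (opy g Gam P s w V).
Proof.
move=> hV; apply: gsecZ; last exact: gsec_IdotD.
by apply: iscalN; apply: iscalV => //; exact: iscal_Isq.
Qed.

Lemma gsec_opx V : gsec V -> gsec (opx s V).
Proof. exact: gsecZ (iscal_fun hs). Qed.

End Sections.

(** * Change of scale *)

Section Rescaling.
Variables (R : realType) (d : nat) (M : manifold R d).
Hypothesis d0 : (0 < d)%N.
Variables (g : field2 M).
Hypotheses (hg : is_metric g).
Implicit Types (i j : chart M) (a b c e : 'I_d) (p : M) (W : set M) (om : M -> R).
Notation idx := (tidx d).

(** Two metrics determine the factor between them, so the choice inside [extend] is immaterial. The
    comparison reads a diagonal entry of g times its inverse, whence d > 0. *)
Lemma rescaled_inj gh om om' : rescaled om g gh -> rescaled om' g gh -> om = om'.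
Proof.
move=> [_ h] [_ h']; apply/funext => p; have [i ip] := cdom_cover p.
have := h i p ip; rewrite (h' i p ip) => /(congr1 (fun A => A *m invmx (g i p))).
have hu : g i p \in unitmx by case: hg => _ _ /(_ i p ip).
rewrite -!scalemxAl mulmxV// => /matrixP/(_ (Ordinal d0) (Ordinal d0)).
rewrite !mxE eqxx !mulr1 => /expR_inj/mulfI => ->//.
Qed.

Lemma rescaled0 : rescaled (fun=> 0) g g.
Proof.
split; first by move=> i; rewrite -sm_setT; apply: sm_cst; exact: openT.
by move=> i p ip; rewrite mulr0 expR0 scale1r.
Qed.

Lemma rescaledD gh gk om om' : rescaled om g gh -> rescaled om' gh gk ->
  rescaled (fun p => om p + om' p) g gk.
Proof.
move=> [s1 h1] [s2 h2]; split.
  by move=> i; rewrite -sm_setT; apply: sm_add; rewrite ?sm_setT//; exact: openT.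
by move=> i p ip; rewrite h2// h1// scalerA -expRD mulrDr addrC.
Qed.

(** The two exponentials are kept apart so that each can cancel one factor [expR (om p)] of a
    slot. *)
Lemma ginv_rescaled gh om i p a b : rescaled om g gh -> cdom i p ->
  ginv gh i p a b = expR (- om p) * (expR (- om p) * ginv g i p a b).
Proof.
move=> [_ h] ip; rewrite /ginv h// invmxZ ?mxE.
  by rewrite mulrA -expRD -expRN; congr (expR _ * _); ring.
rewrite unitmxE detZ unitfE; apply: mulf_neq0.
  by rewrite expf_neq0// gt_eqF// expR_gt0.
by case: hg => _ _ /(_ i p ip); rewrite unitmxE unitfE.
Qed.

Lemma sm_scale_tr i W om B C : open W -> smooth_fun om ->
  sm i W (fun p => scale_tr g om i p B C).
Proof.
move=> oW hom; have so : sm i W om by exact: sm_in.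
have se : sm i W (fun p => expR (om p)) by exact: sm_exp.
have sn : sm i W (fun p => expR (- om p)) by apply: sm_exp => //; exact: sm_opp.
have sU a : sm i W (pd i a om) by exact: sm_pd.
case: B C => [b|[]] [c|[]] /=; try exact: sm_cst; rewrite //.
- by apply: sm_mul => //; exact: sm_cst.
- exact: sm_mul.
- apply: sm_mul => //; first exact: sm_opp.
  apply: sm_sum => // a; apply: sm_mul => //; exact: sm_ginv.
- apply: sm_mul => //; first exact: sm_opp.
  apply: sm_mul => //; first exact: sm_cst.
  by apply: sm_gtrace => // a b; exact: sm_mul.
Qed.

(** Besides powers of [expR (om p)], the entries are the covector d om, the vector obtained by
    raising its index, and its squared norm, all of which transform as tensors. *)
Lemma scale_tr_chart om i j p B C : smooth_fun om -> cdom i p -> cdom j p ->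
  \sum_E scale_tr g om i p B E * chart_tr i j p E C =
  \sum_E chart_tr i j p B E * scale_tr g om j p E C.
Proof.
move=> hom ip jp.
have ch a : pd i a om p = \sum_e jac i j p a e * pd j e om p.
  by apply: (@pd_chain _ _ _ i j a setT); rewrite ?sm_setT//; exact: openT.
rewrite !big_tidx.
case: B C => [b|[]] [c|[]] /=; rewrite ?(mul0r, mul1r, mulr0, mulr1).
all: rewrite ?(sum_0l, sum_0r, add0r, addr0)//.
- under eq_bigr do rewrite -mulrA.
  under [RHS]eq_bigr do rewrite mulrCA eq_sym.
  by rewrite -!mulr_sumr sum_delta sum_deltar.
- by rewrite ch mulr_sumr; apply: eq_bigr => e _; rewrite mulrCA.
- by rewrite big1_eq addr0.
- under eq_bigr do rewrite -mulrA.
  rewrite -mulr_sumr; congr (_ * _).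
  under [RHS]eq_bigr do rewrite (ginv_chartE hg _ _ ip jp) mulr_suml.
  rewrite [RHS]exchange_big/=.
  under eq_bigr do rewrite mulr_suml.
  rewrite exchange_big/=; apply: eq_bigr => a _.
  under [RHS]eq_bigr do rewrite mulr_suml.
  rewrite [RHS]exchange_big/=; apply: eq_bigr => b _.
  rewrite ch mulr_sumr mulr_suml; apply: eq_bigr => e _; ring.
- congr (_ * (_ * _)); apply: (gtrace_chart hg ip jp) => a b.
  rewrite !ch mulr_suml; apply: eq_bigr => c _.
  rewrite mulr_sumr; apply: eq_bigr => e _; ring.
- by rewrite big1_eq add0r.
Qed.

Lemma gtrace_sq i p (x y : 'I_d -> R) : cdom i p ->
  gtrace g i (fun a b => (x a + y a) * (x b + y b)) p =
  gtrace g i (fun a b => x a * x b) p + gtrace g i (fun a b => y a * y b) p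
  + 2 * gtrace g i (fun a b => y a * x b) p.
Proof.
move=> ip.
have -> : 2 * gtrace g i (fun a b => y a * x b) p =
    gtrace g i (fun a b => y a * x b) p + gtrace g i (fun a b => x a * y b) p.
  rewrite mulr_natl mulr2n; congr (_ + _); rewrite [RHS]/gtrace exchange_big/=.
  apply: eq_bigr => a _; apply: eq_bigr => b _.
  by rewrite (ginv_sym hg _ _ ip) (mulrC (x b)).
rewrite /gtrace -!big_split; apply: eq_bigr => a _.
by rewrite -!big_split; apply: eq_bigr => b _ /=; ring.
Qed.

(** The cocycle law. In the entry from the top slot to the bottom one, the cross term of the squared
    norm of d om + d om' comes from the product through the covector slots; the second matrix uses
    the inverse of [gh], hence the extra exponentials. *)
Lemma scale_tr_comp gh om om' i p B C : rescaled om g gh -> smooth_fun om' ->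
  cdom i p ->
  \sum_E scale_tr gh om' i p B E * scale_tr g om i p E C =
  scale_tr g (fun p => om p + om' p) i p B C.
Proof.
move=> hr hom' ip.
have pdD a : pd i a (fun p => om p + om' p) p = pd i a om p + pd i a om' p.
  case: hr => hom _; apply: ispd_pd; apply: ispdD.
    by apply: (sm_ispd _ (W := setT)); rewrite ?sm_setT.
  by apply: (sm_ispd _ (W := setT)); rewrite ?sm_setT.
have hFE : expR (- om p) * expR (om p) = 1 by rewrite -expRD addNr expR0.
have Q a : \sum_x ginv gh i p x a * pd i x om' p =
    expR (- om p) * (expR (- om p) * \sum_x ginv g i p x a * pd i x om' p).
  rewrite !mulr_sumr; apply: eq_bigr => x _.
  by rewrite (ginv_rescaled _ _ hr ip) -!mulrA.
rewrite !big_tidx.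
case: B C => [b|[]] [c|[]] /=; rewrite ?(mul0r, mul1r, mulr0, mulr1).
all: rewrite ?(sum_0l, sum_0r, add0r, addr0)//.
- under eq_bigr do rewrite -mulrA.
  by rewrite -mulr_sumr sum_delta expRD; ring.
- under eq_bigr do rewrite -mulrA.
  by rewrite -mulr_sumr sum_delta expRD pdD; ring.
- by rewrite expRD mulrC.
- by rewrite big1_eq.
- rewrite (eq_bigr (fun a => - expR (- om' p) * expR (- om p) *
      ((\sum_x ginv g i p x a * pd i x om' p) * (c == a)%:R))); last first.
    by move=> a _; rewrite Q eq_sym -[RHS]mulr1 -hFE; ring.
  rewrite -mulr_sumr sum_deltar opprD expRD.
  under [in RHS]eq_bigr do rewrite pdD mulrDr.
  by rewrite big_split/=; ring.
- have -> : gtrace gh i (fun a b => pd i a om' p * pd i b om' p) p =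
      expR (- om p) * (expR (- om p) *
        gtrace g i (fun a b => pd i a om' p * pd i b om' p) p).
    rewrite /gtrace !mulr_sumr; apply: eq_bigr => a _.
    rewrite !mulr_sumr; apply: eq_bigr => b _.
    by rewrite (ginv_rescaled _ _ hr ip) -!mulrA.
  rewrite (eq_bigr (fun a => - expR (- om' p) * expR (- om p) *
      ((\sum_x ginv g i p x a * pd i x om' p) * pd i a om p))); last first.
    by move=> a _; rewrite Q -[RHS]mulr1 -hFE; ring.
  rewrite -mulr_sumr.
  have -> : \sum_a (\sum_x ginv g i p x a * pd i x om' p) * pd i a om p =
      gtrace g i (fun a b => pd i a om' p * pd i b om p) p.
    under eq_bigr do rewrite mulr_suml.
    rewrite exchange_big; apply: eq_bigr => a _; apply: eq_bigr => b _.
    by rewrite mulrA.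
  have -> : (fun a b => pd i a (fun p0 => om p0 + om' p0) p *
        pd i b (fun p0 => om p0 + om' p0) p) =
      (fun a b => (pd i a om p + pd i a om' p) * (pd i b om p + pd i b om' p)).
    by apply/funext => a; apply/funext => b; rewrite !pdD.
  rewrite gtrace_sq// opprD expRD.
  set F1 := expR (- om p); set E1 := expR (om p).
  set G := gtrace g i _ p; set G' := gtrace g i _ p; set X := gtrace g i _ p.
  have -> : - expR (- om' p) * (2^-1 * (F1 * (F1 * G))) * E1 =
      - expR (- om' p) * F1 * (2^-1 * G).
    by rewrite -[RHS]mulr1 -hFE -/F1 -/E1; ring.
  by field.
- by rewrite opprD expRD mulrC.
Qed.

Lemma tmet_sum (G : 'M[R]_d) (X Y : idx -> R) :
  \sum_B \sum_C tmet G B C * (X B * Y C) =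
  X itop * Y ibot + X ibot * Y itop +
  \sum_b \sum_c invmx G b c * (X (inl b) * Y (inl c)).
Proof.
rewrite big_tidx !big_tidx/= !sum_0l !(mul0r, mul1r, add0r, addr0).
rewrite addrAC; congr (_ + _); apply: eq_bigr => b _.
by rewrite big_tidx/= !mul0r add0r addr0.
Qed.

Lemma tmetinv_sum (G : 'M[R]_d) (X Y : idx -> R) :
  \sum_B \sum_C X B * Y C * tmetinv G B C =
  X itop * Y ibot + X ibot * Y itop +
  \sum_b \sum_c X (inl b) * Y (inl c) * G b c.
Proof.
rewrite big_tidx !big_tidx/= !sum_0r !(mulr0, mulr1, add0r, addr0).
rewrite addrAC; congr (_ + _); apply: eq_bigr => b _.
by rewrite big_tidx/= !mulr0 add0r addr0.
Qed.

(** The change of splitting is an isometry. By [K], the factor exp(-2 om) in the inverse of [gh]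
    cancels the exponentials of two covector slots. *)
Lemma tmet_scale gh om i p B' C' : rescaled om g gh -> cdom i p ->
  \sum_B \sum_C tmet (gh i p) B C *
     (scale_tr g om i p B B' * scale_tr g om i p C C') = tmet (g i p) B' C'.
Proof.
move=> hr ip.
rewrite (tmet_sum (gh i p) (fun B => scale_tr g om i p B B')
  (fun C => scale_tr g om i p C C')).
have hFE : expR (- om p) * expR (om p) = 1 by rewrite -expRD addNr expR0.
set U := fun a => pd i a om p.
have QT c : \sum_x ginv g i p x c * U x = \sum_x ginv g i p c x * U x.
  by apply: eq_bigr => x _; rewrite (ginv_sym hg).
have K (x y : 'I_d -> R) : \sum_b \sum_c invmx (gh i p) b c *
    (expR (om p) * x b * (expR (om p) * y c)) =
    \sum_b \sum_c ginv g i p b c * (x b * y c).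
  apply: eq_bigr => b _; apply: eq_bigr => c _.
  rewrite -[invmx _ _ _]/(ginv gh i p b c) (ginv_rescaled _ _ hr ip).
  by rewrite -[RHS]mul1r -[X in _ = X * _]mulr1 -hFE; ring.
case: B' C' => [b|[]] [c|[]] /=; rewrite ?(mul0r, mulr0, add0r, addr0).

- rewrite (K (fun x => (x == b)%:R) (fun x => (x == c)%:R)).
  under eq_bigr do under eq_bigr do rewrite mulrA (eq_sym _ b) (eq_sym _ c).
  by under eq_bigr do rewrite sum_deltar; rewrite sum_deltar.
- rewrite (K (fun x => (x == b)%:R) U).
  under [X in _ + X]eq_bigr do under eq_bigr do rewrite mulrCA (eq_sym _ b).
  under [X in _ + X]eq_bigr do rewrite -mulr_sumr.
  by rewrite sum_delta QT mulrAC mulNr hFE mulN1r addNr.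
- by apply: big1 => x _; apply: big1 => y _; ring.
- rewrite (K U (fun x => (x == c)%:R)).
  under [X in _ + X]eq_bigr do under eq_bigr do rewrite mulrA (eq_sym _ c).
  under [X in _ + X]eq_bigr do rewrite sum_deltar.
  by rewrite mulrA mulrN [_ * expR (- _)]mulrC hFE mulN1r addNr.
(* The triple (1, U, -|U|^2/2) is null: twice the product of its outer entries cancels |U|^2. *)
- rewrite (K U U) -[X in _ + X = 0]/(gtrace g i (fun a b => U a * U b) p).
  set G := gtrace g i _ p.
  rewrite [X in X + _ + _](_ : _ = - (expR (- om p) * expR (om p)) * (2^-1 * G)).
    rewrite [X in _ + X + _](_ : _ = - (expR (- om p) * expR (om p)) * (2^-1 * G)).
      by rewrite hFE; field.
    by ring.
  by ring.
- rewrite mulrC hFE big1 ?addr0// => x _; apply: big1 => y _; ring.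
- by apply: big1 => x _; apply: big1 => y _; ring.
- rewrite hFE big1 ?addr0// => x _; apply: big1 => y _; ring.
- by apply: big1 => x _; apply: big1 => y _; ring.
Qed.

(** The isometry for the inverse metric, where rows of [scale_tr] are paired instead of columns.
    [QG] lowers the index that the bottom row has raised. *)
Lemma tmetinv_scale gh om i p B' C' : rescaled om g gh -> cdom i p ->
  tmetinv (gh i p) B' C' = \sum_B \sum_C scale_tr g om i p B' B *
     scale_tr g om i p C' C * tmetinv (g i p) B C.
Proof.
move=> hr ip; rewrite tmetinv_sum.
have hFE : expR (- om p) * expR (om p) = 1 by rewrite -expRD addNr expR0.
have hgh b c : gh i p b c = expR (om p) * (expR (om p) * g i p b c).
  by case: hr => _ h; rewrite h// mxE mulrA -expRD; congr (expR _ * _); ring.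
have QG c : \sum_b (\sum_a ginv g i p a b * pd i a om p) * g i p b c = pd i c om p.
  under eq_bigr do rewrite mulr_suml; rewrite exchange_big/=.
  under eq_bigr do under eq_bigr do rewrite mulrAC.
  under eq_bigr do rewrite -mulr_suml (ginv_mul hg)// eq_sym.
  by rewrite sum_delta.
case: B' C' => [b|[]] [c|[]] /=; rewrite ?(mul0r, mulr0, add0r, addr0).
- rewrite (eq_bigr (fun x => (b == x)%:R *
    (expR (om p) * (expR (om p) * g i p x c)))); first by rewrite sum_delta hgh.
  move=> x _; rewrite (eq_bigr (fun y => (c == y)%:R *
    ((b == x)%:R * (expR (om p) * (expR (om p) * g i p x y))))).
    by rewrite sum_delta.
  by move=> y _; ring.
- by apply/esym; apply: big1 => x _; apply: big1 => y _; ring.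
- rewrite (eq_bigr (fun x => (b == x)%:R * (- (expR (- om p) * expR (om p)) *
      \sum_y (\sum_a ginv g i p a y * pd i a om p) * g i p x y))).
    rewrite sum_delta hFE [X in _ + _ * X](_ : _ = pd i b om p).
      by rewrite mulrAC [_ * expR (- _)]mulrC hFE; ring.
    rewrite -QG; apply: eq_bigr => y _; congr (_ * _).
    by case: hg => _ /(_ i p ip)/matrixP/(_ b y) + _; rewrite mxE => ->.
  by move=> x _; rewrite !mulr_sumr; apply: eq_bigr => y _; ring.
- by apply/esym; apply: big1 => x _; apply: big1 => y _; ring.
- by apply/esym; apply: big1 => x _; apply: big1 => y _; ring.
- by rewrite mulrC hFE big1 ?addr0// => x _; apply: big1 => y _; ring.
- rewrite exchange_big/= (eq_bigr (fun x => (c == x)%:R *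
      (- (expR (- om p) * expR (om p)) *
      \sum_y (\sum_a ginv g i p a y * pd i a om p) * g i p y x))).
    by rewrite sum_delta QG mulrA hFE; ring.
  by move=> x _; rewrite !mulr_sumr; apply: eq_bigr => y _; ring.
- by rewrite hFE big1 ?addr0// => x _; apply: big1 => y _; ring.
- rewrite exchange_big/= (eq_bigr (fun x => (expR (- om p) * expR (- om p)) *
      (pd i x om p * \sum_a ginv g i p a x * pd i a om p))).
    rewrite -mulr_sumr (_ : \sum_x _ =
      gtrace g i (fun a b => pd i a om p * pd i b om p) p); first by field.
    under eq_bigr do rewrite mulr_sumr; rewrite exchange_big/=.
    by apply: eq_bigr => a _; apply: eq_bigr => b _; ring.
  move=> x _; rewrite -(QG x) mulr_suml mulr_sumr; apply: eq_bigr => y _.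
  ring.
Qed.

End Rescaling.

(** * From one scale to the whole conformal class *)

Section Extension.
Variables (R : realType) (d : nat) (M : manifold R d).
Hypothesis d0 : (0 < d)%N.
Variables (c : set (field2 M)) (g : field2 M).
Hypotheses (hc : is_conformal_class c) (cg : c g).
Notation idx := (tidx d).

(* Junk value 0 at metrics that are not conformal to [g]. *)
Definition extend k (w : R) (V : tfield M k) : field2 M -> tfield M k :=
  fun gh i A p =>
    if pselect (exists om, rescaled om g gh) is left H then
      let om := sval (cid H) in
      expR (w * om p) * tact (scale_tr g om i p) (fun B => V i B p) A
    else 0.

Let hg : is_metric g. Proof. by case: hc => _ h _; exact: h. Qed.

Lemma extendE k w (V : tfield M k) gh om i A p : rescaled om g gh ->
  extend w V gh i A p =
  expR (w * om p) * tact (scale_tr g om i p) (fun B => V i B p) A.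
Proof.
move=> h; rewrite /extend; case: pselect => [H|]; last by case; exists om.
by case: cid => om' h' /=; rewrite (rescaled_inj d0 hg h' h).
Qed.

Lemma extend_id k w (V : tfield M k) i A p : extend w V g i A p = V i A p.
Proof.
rewrite (extendE _ _ _ _ _ (rescaled0 g)) mulr0 expR0 mul1r.
rewrite -[RHS](tact1 (fun B => V i B p)).
suff -> : scale_tr g (fun=> 0) i p = fun B C => (B == C)%:R by [].
apply/funext => B; apply/funext => C.
case: B C => [a|[]] [b|[]] //=; rewrite ?pd_cst ?oppr0 ?expR0 ?mul1r//.
- by rewrite big1 ?mulr0// => e _; rewrite pd_cst mulr0.
- rewrite /gtrace big1 ?mulr0// => a _; rewrite big1// => b _.
  by rewrite !pd_cst !mulr0.
Qed.

(** The law between two arbitrary scales is the cocycle identity. Chart covariance survives because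
    [scale_tr] commutes with [chart_tr], and the constraint because [scale_tr] is an isometry. *)
Lemma is_section_extend Phi w (V : tfield M (rank Phi)) : gsec g V ->
  is_section c w (extend w V : tsection M Phi).
Proof.
move=> [v1 v2 v3].
have cR gh : c gh -> exists om, rescaled om g gh.
  by case: hc => _ _ H; move/(H g gh cg).
split.
- move=> gh i A /cR[om h]; rewrite -sm_setT.
  rewrite (_ : extend w V gh i A = fun p =>
      expR (w * om p) * tact (scale_tr g om i p) (fun B => V i B p) A); last first.
    by apply/funext => p; exact: extendE.
  have o := @openT M; have so : sm i setT om by rewrite sm_setT; case: h.
  apply: sm_mul => //; first by apply: sm_exp => //; apply: sm_mul => //; exact: sm_cst.
  apply: sm_sum => // B; apply: sm_mul; rewrite ?sm_setT//.
  by rewrite -sm_setT; apply: sm_prod => // m; apply: sm_scale_tr => //; case: h.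
- move=> gh i j p A /cR[om h] ip jp.
  rewrite -[RHS]/(tact (chart_tr i j p) (fun B => extend w V gh j B p) A).
  rewrite (_ : (fun B => extend w V gh j B p) = fun B =>
      expR (w * om p) * tact (scale_tr g om j p) (fun C => V j C p) B); last first.
    by apply/funext => B; exact: extendE.
  rewrite tactZ (extendE _ _ _ _ _ h); congr (_ * _).
  rewrite (_ : (fun B => V i B p) = tact (chart_tr i j p) (fun B => V j B p)); last first.
    by apply/funext => B; exact: v2.
  rewrite !tact_comp; congr (tact _ _ _); apply/funext => B; apply/funext => C.
  by apply: scale_tr_chart => //; case: h.
- move=> gh gk om' i p A /cR[om h] h' ip.
  rewrite -[X in _ * X]/(tact (scale_tr gh om' i p) (fun B => extend w V gh i B p) A).
  rewrite (_ : (fun B => extend w V gh i B p) = fun B =>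
      expR (w * om p) * tact (scale_tr g om i p) (fun C => V i C p) B); last first.
    by apply/funext => B; exact: extendE.
  rewrite tactZ tact_comp (extendE _ _ _ _ _ (rescaledD h h')).
  rewrite mulrA -expRD; congr (_ * _); first by congr expR; ring.
  congr (tact _ _ _); apply/funext => B; apply/funext => C; apply/esym/scale_tr_comp => //.
  by case: h'.
- move=> gh i p A /cR[om h] ip.
  rewrite (_ : (fun B => extend w V gh i B p) = fun B =>
      expR (w * om p) * tact (scale_tr g om i p) (fun C => V i C p) B); last first.
    by apply/funext => B; exact: extendE.
  rewrite op_semZ (@tensor_op_tact _ _ (g i p)).
  + rewrite (_ : op_sem (g i p) _ _ = fun=> 0); last first.
      by apply/funext => B; exact: v3.
    by rewrite /tact big1 ?mulr0// => B _; rewrite mulr0.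
  + by move=> B' C'; exact: tmet_scale.
  + by move=> B' C'; exact: tmetinv_scale.
Qed.

Lemma gsec_section Phi w (V : tsection M Phi) : is_section c w V -> gsec g (V g).
Proof.
move=> [v1 v2 _ v4]; split.
- by move=> i A; exact: v1.
- by move=> i j A p ip jp; exact: v2.
- by move=> i p A ip; exact: v4.
Qed.

(** [zero_locus] asks for vanishing in all scales, but scales differ by positive factors, so one
    scale decides. *)
Lemma density_off_zero (sigma : density M) p : is_density c 1 sigma ->
  ~ zero_locus c sigma p -> sigma g p != 0.
Proof.
move=> [_ hs] nz; apply: contra_notN nz => /eqP s0 gh cgh.
have [om h] : exists om, rescaled om g gh.
  by case: hc => _ _ H; move/(H g gh cg): cgh.
by rewrite (hs g gh om cg h) s0 mulr0.
Qed.

End Extension.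

(** * Leibniz rules *)

Section Leibniz.
Variables (R : realType) (d : nat) (M : manifold R d).
Variables (g : field2 M) (Gam : christoffel M) (P : field2 M) (s : M -> R).
Hypotheses (hg : is_metric g) (hGam : is_levi_civita g Gam) (hP : is_field2 P).
Hypothesis hs : smooth_fun s.
Implicit Types (i j : chart M) (a b c e : 'I_d) (p : M) (W : set M).
Notation idx := (tidx d).

Lemma gtraceD i p (T T' : 'I_d -> 'I_d -> R) :
  gtrace g i (fun a b => T a b + T' a b) p = gtrace g i T p + gtrace g i T' p.
Proof.
rewrite /gtrace -big_split; apply: eq_bigr => a _; rewrite -big_split/=.
by apply: eq_bigr => b _; rewrite mulrDr.
Qed.

Lemma gtraceZ i p x (T : 'I_d -> 'I_d -> R) :
  gtrace g i (fun a b => x * T a b) p = x * gtrace g i T p.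
Proof.
rewrite /gtrace mulr_sumr; apply: eq_bigr => a _; rewrite mulr_sumr.
by apply: eq_bigr => b _; rewrite mulrCA.
Qed.

Lemma gtrace_swap i p (T : 'I_d -> 'I_d -> R) : cdom i p ->
  gtrace g i (fun a b => T b a) p = gtrace g i T p.
Proof.
move=> ip; rewrite /gtrace exchange_big/=.
by apply: eq_bigr => a _; apply: eq_bigr => b _; rewrite (ginv_sym hg).
Qed.

Lemma tD_near k i W a (V V' : k.-tuple idx -> M -> R) A p : open W -> W p ->
  cdom i p -> (forall B, sm i W (V B)) ->
  (forall B q, cdom i q -> W q -> V B q = V' B q) ->
  tD g Gam P i a V' A p = tD g Gam P i a V A p.
Proof.
move=> oW Wp ip hV VV'; rewrite !tDE; congr (_ + _).
  apply: ispd_pd; apply: (@ispd_near _ _ _ i a W (V A)) => //.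
    by move=> q iq Wq; exact: VV'.
  exact: sm_ispd Wp.
by congr dact; apply/funext => B; rewrite VV'.
Qed.

Lemma tD_mul k i W a f l (V : k.-tuple idx -> M -> R) A p :
  W p -> cdom i p -> sm i W (V A) -> ispd i a f p l ->
  tD g Gam P i a (fun B q => f q * V B q) A p =
  f p * tD g Gam P i a V A p + l * V A p.
Proof.
move=> Wp ip hV hf; rewrite !tDE.
have /ispd_pd -> := ispdM ip hf (sm_ispd a hV ip Wp).
rewrite (_ : dact _ _ A = f p * dact (fun B C => tcoef g Gam P i a B C p)
  (fun B => V B p) A); first by ring.
rewrite /dact mulr_sumr; apply: eq_bigr => m _; rewrite mulr_sumr.
by apply: eq_bigr => B _; rewrite mulrCA.
Qed.

Lemma tD_add k i W a (V V' : k.-tuple idx -> M -> R) A p :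
  W p -> cdom i p -> sm i W (V A) -> sm i W (V' A) ->
  tD g Gam P i a (fun B q => V B q + V' B q) A p =
  tD g Gam P i a V A p + tD g Gam P i a V' A p.
Proof.
move=> Wp ip hV hV'; rewrite !tDE.
have /ispd_pd -> := ispdD (sm_ispd a hV ip Wp) (sm_ispd a hV' ip Wp).
rewrite (_ : dact _ _ A = dact (fun B C => tcoef g Gam P i a B C p)
  (fun B => V B p) A + dact (fun B C => tcoef g Gam P i a B C p)
  (fun B => V' B p) A); first by ring.
rewrite /dact -big_split; apply: eq_bigr => m _; rewrite -big_split/=.
by apply: eq_bigr => B _; rewrite mulrDr.
Qed.

(** * Leibniz rules for phi V, where phi is a function of [s] with derivatives psi and chi *)

Section Product.
Variables (i : chart M) (W : set M) (k : nat) (phi psi : M -> R) (chi : R).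
Variables (V : tfield M k) (p : M).
Hypotheses (oW : open W) (Wp : W p) (ip : cdom i p).
Hypothesis hV : forall A, sm i W (V i A).
Hypotheses (sphi : sm i W phi) (spsi : sm i W psi).
Hypothesis dphi : forall a q, cdom i q -> W q ->
  ispd i a phi q (psi q * nu s i a q).
Hypothesis dpsi : forall a, ispd i a psi p (chi * nu s i a p).

Let phiV : tfield M k := fun i A q => phi q * V i A q.

Lemma tD_phi a A q : cdom i q -> W q ->
  tD g Gam P i a (phiV i) A q =
  phi q * tD g Gam P i a (V i) A q + psi q * nu s i a q * V i A q.
Proof. by move=> iq Wq; apply: (tD_mul Wq) => //; exact: dphi. Qed.

(** The Hessian of [phi] is chi ds ds plus psi times the Hessian of [s]. The number [chi] suffices
    because the derivative of [psi] is evaluated only at [p]. *)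
Lemma tD2_phi a b A :
  tD2 g Gam P i a b (phiV i) A p =
  phi p * tD2 g Gam P i a b (V i) A p
  + psi p * (nu s i a p * tD g Gam P i b (V i) A p
             + nu s i b p * tD g Gam P i a (V i) A p)
  + (chi * (nu s i a p * nu s i b p)
     + psi p * (pd i a (pd i b s) p - \sum_c Gam i c a b p * pd i c s p))
    * V i A p.
Proof.
have snu e : sm i W (nu s i e) by exact: sm_nu.
have sD e B : sm i W (tD g Gam P i e (V i) B) by exact: sm_tD.
rewrite /tD2 (@tD_near _ i W a (fun B q => phi q * tD g Gam P i b (V i) B q +
    (psi q * nu s i b q) * V i B q)) //; first last.
- by move=> B q iq Wq; rewrite tD_phi.
- move=> B; apply: sm_add => //; first exact: sm_mul.
  by apply: sm_mul => //; exact: sm_mul.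
rewrite (tD_add _ Wp ip); first last.
- by apply: sm_mul => //; exact: sm_mul.
- exact: sm_mul.
rewrite (tD_mul Wp ip (sD b A) (dphi a ip Wp)).
have dpn := ispdM ip (dpsi a) (sm_ispd a (snu b) ip Wp).
rewrite (tD_mul Wp ip (hV A) dpn).
under eq_bigr do rewrite tD_phi// mulrDr.
rewrite big_split/=.
have -> : \sum_c Gam i c a b p * (phi p * tD g Gam P i c (V i) A p) =
    phi p * \sum_c Gam i c a b p * tD g Gam P i c (V i) A p.
  by rewrite mulr_sumr; apply: eq_bigr => c _; rewrite mulrCA.
have -> : \sum_c Gam i c a b p * (psi p * nu s i c p * V i A p) =
    psi p * (\sum_c Gam i c a b p * pd i c s p) * V i A p.
  by rewrite mulr_sumr mulr_suml; apply: eq_bigr => c _; rewrite /nu; ring.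
rewrite -[pd i a (pd i b s) p]/(pd i a (nu s i b) p); ring.
Qed.

Let Nu2 := gtrace g i (fun a b => nu s i a p * nu s i b p) p.
Let Grad A := gtrace g i (fun a b => nu s i a p * tD g Gam P i b (V i) A p) p.

Lemma tlap_phi A : tlap g Gam P i (phiV i) A p =
  phi p * tlap g Gam P i (V i) A p + 2 * psi p * Grad A
  + (chi * Nu2 + psi p * lap g Gam i s p) * V i A p.
Proof.
rewrite /tlap (_ : (fun a b => tD2 g Gam P i a b (phiV i) A p) = fun a b =>
  phi p * tD2 g Gam P i a b (V i) A p
  + psi p * (nu s i a p * tD g Gam P i b (V i) A p
             + nu s i b p * tD g Gam P i a (V i) A p)
  + V i A p * (chi * (nu s i a p * nu s i b p)
     + psi p * (pd i a (pd i b s) p - \sum_c Gam i c a b p * pd i c s p)));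
  last by apply/funext => a; apply/funext => b; rewrite tD2_phi; ring.
rewrite /lap !(gtraceD, gtraceZ).
rewrite (gtrace_swap (fun a b => nu s i a p * tD g Gam P i b (V i) A p))//.
rewrite -/Nu2 -/(Grad A); ring.
Qed.

Lemma grad_phi A :
  gtrace g i (fun a b => nu s i a p * tD g Gam P i b (phiV i) A p) p =
  phi p * Grad A + psi p * Nu2 * V i A p.
Proof.
rewrite (_ : (fun a b => _) = fun a b =>
  phi p * (nu s i a p * tD g Gam P i b (V i) A p) +
  psi p * V i A p * (nu s i a p * nu s i b p)); last first.
  by apply/funext => a; apply/funext => b; rewrite tD_phi//; ring.
rewrite gtraceD !gtraceZ -/Nu2 -/(Grad A); ring.
Qed.

(* [lap s] and [|nu|^2] have been eliminated in favour of [rho] and [I^2]. *)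
Lemma IdotD_phi w A : (0 < d)%N ->
  let r := rho g Gam P s i p in
  let N := Isq g Gam P s i p - 2 * s p * r in
  IdotD g Gam P s w phiV i A p =
  (d%:R + 2 * w - 2) * (phi p * Grad A + psi p * N * V i A p
    + w * r * (phi p * V i A p))
  - s p * (phi p * tlap g Gam P i (V i) A p + 2 * psi p * Grad A
    + (chi * N - psi p * (d%:R * r + Jtrace g P i p * s p)) * V i A p
    + Jtrace g P i p * w * (phi p * V i A p)).
Proof.
move=> d0 r N.
have -> : N = Nu2 by rewrite /N /Isq -/Nu2 -/r; ring.
rewrite /IdotD tlap_phi grad_phi -/r.
have -> : lap g Gam i s p = - (d%:R * r + Jtrace g P i p * s p).
  have dn0 : d%:R != 0 :> R by rewrite pnatr_eq0 -lt0n.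
  by rewrite /r /rho; field.
rewrite /phiV; ring.
Qed.

End Product.

End Leibniz.

(** * Real powers of nonzero numbers *)

Section Spow.
Variable R : realType.

Lemma is_derive_exprn (n : nat) (x : R) : x != 0 ->
  is_derive x (1 : R) (fun y => y ^+ n) (n%:R * x ^+ n / x).
Proof.
move=> x0; elim: n => [|n IH].
  by under eq_fun do rewrite expr0; rewrite mul0r mul0r; exact: is_derive_fc.
under eq_fun do rewrite exprS.
have id1 : is_derive x (1 : R) (fun y : R => y) 1 by exact: is_derive_id.
apply: (is_derive_eq (is_derive_fM id1 IH)).
by rewrite -natr1 exprS; field.
Qed.

Lemma is_derive_exprz (n : int) (x : R) : x != 0 ->
  is_derive x (1 : R) (fun y => y ^ n) (n%:~R * x ^ n / x).
Proof.
move=> x0; case: n => n; first exact: is_derive_exprn.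
have xn0 : x ^+ n.+1 != 0 by rewrite expf_neq0.
have -> : (fun y : R => y ^ Negz n) = (fun y => (y ^+ n.+1)^-1) by [].
have h := @is_derive_fV R R (fun y : R => y ^+ n.+1) x 1 _ xn0 (is_derive_exprn n.+1 x0).
apply: (is_derive_eq h).
rewrite -[x ^ Negz n]/((x ^+ n.+1)^-1) NegzE mulrNz -pmulrn.
by field; rewrite xn0 x0.
Qed.

(** Dividing by [x], rather than lowering the exponent in [spow], gives one formula for both signs
    of [x]: for non-integral [al] and negative [x] the two differ in sign. *)
Lemma is_derive_spow (al x : R) : x != 0 ->
  is_derive x (1 : R) (fun y => spow y al) (al * spow x al / x).
Proof.
move=> x0; rewrite /spow; case: ifPn => hal.
  by have := is_derive_exprz (Num.floor al) x0; rewrite floorK.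
have E (z : R) : 0 < z -> al * z `^ (al - 1) = al * z `^ al / z.
  by move=> z0; rewrite powRB ?(gt_eqF z0) ?implybT// powRr1 ?mulrA// ltW.
have [xlt|xgt|/eqP] := ltgtP x 0; last by rewrite (negbTE x0).
- apply: (@near_eq_is_derive _ _ _ (fun y => (- y) `^ al)).
    near=> y; rewrite ltr0_norm//; near: y; exact: lt_nbhsl.
  have nx : 0 < - x by rewrite oppr_gt0.
  have dn : is_derive x (1 : R) (fun y : R => - y) (- 1) by exact: is_deriveN.
  apply: (is_derive_eq (is_derive_comp1 dn (is_derive1_powR al nx))).
  by rewrite E// ltr0_norm// invrN; ring.
- apply: (@near_eq_is_derive _ _ _ (fun y => y `^ al)).
    near=> y; rewrite gtr0_norm//; near: y; exact: lt_nbhsr.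
  apply: (is_derive_eq (is_derive1_powR al xgt)).
  by rewrite E// gtr0_norm.
Unshelve. all: by end_near. Qed.

Lemma Ck_spow d (al : R) k (O : set 'rV[R]_d) f : open O ->
  (forall x, O x -> f x != 0) -> Ck k O f -> Ck k O (fun x => spow (f x) al).
Proof.
move=> oO f0.
have cts h x : Ck h O f -> O x -> {for x, continuous (fun x => spow (f x) al)}.
  move=> Hf Ox; apply: (@continuous_comp _ _ _ f (fun y => spow y al)).
    exact: Ck_cont Hf Ox.
  have [/derivable1_diffP dd _] := is_derive_spow al (f0 x Ox).
  exact: differentiable_continuous.
elim: k => [|k IH] Hf; first by split=> // x Ox; exact: cts Hf Ox.
apply: (@Ck_build _ _ _ _ _ (fun a x =>
    al * (spow (f x) al * (f x)^-1) * partial a f x)) => //.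
- by move=> x Ox; exact: cts Hf Ox.
- move=> a x Ox; rewrite mulrA.
  exact: (is_derive_comp1 (Ck_pd a Hf Ox) (is_derive_spow al (f0 x Ox))).
- move=> a; apply: Ck_mul => //; last by case: Hf => _ /(_ a)[].
  apply: Ck_mul => //; first exact: Ck_cst.
  apply: Ck_mul => //; first exact: IH (CkS Hf).
  exact: Ck_inv (CkS Hf).
Qed.

End Spow.

Lemma sm_spow (R : realType) d (M : manifold R d) (i : chart M) (W : set M)
    (al : R) f : open W -> (forall p, cdom i p -> W p -> f p != 0) ->
  sm i W f -> sm i W (fun p => spow (f p) al).
Proof.
move=> oW f0 Hf k; apply: (Ck_spow _ _ _ (Hf k)); first exact: image_open.
by move=> _ [p [ip Wp] <-] /=; rewrite cinvK// f0.
Qed.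

(** * The operators x, y and h *)

Section Algebra.
Variables (R : realType) (d : nat) (M : manifold R d).
Variables (g : field2 M) (Gam : christoffel M) (P : field2 M) (s : M -> R).
Hypothesis d0 : (0 < d)%N.
Hypotheses (hg : is_metric g) (hGam : is_levi_civita g Gam) (hP : is_field2 P).
Hypothesis hs : smooth_fun s.
Hypothesis hI : forall i p, cdom i p -> Isq g Gam P s i p != 0.
Implicit Types (i j : chart M) (p : M).
Notation idx := (tidx d).
Notation y := (opy g Gam P s).
Notation ID := (IdotD g Gam P s).
Notation smooth_field V := (forall i A, smooth_in i (V i A)).

(** Components off the chart domain are arbitrary, so identities of fields are asserted on it only;
    [opy_eqv] allows rewriting with them under [y]. *)
Definition eqv k (U V : tfield M k) : Prop :=
  forall i A p, cdom i p -> U i A p = V i A p.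

Section Fields.
Variable k : nat.
Implicit Types U V : tfield M k.

Lemma tD_eqv U V i a A p : smooth_field U -> eqv U V -> cdom i p ->
  tD g Gam P i a (V i) A p = tD g Gam P i a (U i) A p.
Proof.
move=> hU UV ip; apply: (@tD_near _ _ _ _ _ _ _ i setT) => //.
- exact: openT.
- by move=> B; rewrite sm_setT.
- by move=> B q iq _; exact: UV.
Qed.

Lemma smooth_tD U i a A : smooth_field U -> smooth_in i (tD g Gam P i a (U i) A).
Proof.
move=> hU; rewrite -sm_setT; apply: sm_tD => //; first exact: openT.
by move=> B; rewrite sm_setT.
Qed.

Lemma tlap_eqv U V i A p : smooth_field U -> eqv U V -> cdom i p ->
  tlap g Gam P i (V i) A p = tlap g Gam P i (U i) A p.
Proof.
move=> hU UV ip; rewrite /tlap; congr gtrace.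
apply/funext => a; apply/funext => b; rewrite /tD2; congr (_ - _).
  apply: (@tD_near _ _ _ _ _ _ _ i setT) => //.
  - exact: openT.
  - by move=> B; rewrite sm_setT; exact: smooth_tD.
  - by move=> B q iq _; apply/esym/tD_eqv.
by apply: eq_bigr => c _; rewrite (tD_eqv _ _ hU UV).
Qed.

Lemma opy_eqv w U V : smooth_field U -> eqv U V -> eqv (y w U) (y w V).
Proof.
move=> hU UV i A p ip; rewrite /opy /IdotD -(UV i A p ip).
rewrite (tlap_eqv _ hU UV ip).
rewrite (_ : (fun a b => nu s i a p * tD g Gam P i b (V i) A p) =
  (fun a b => nu s i a p * tD g Gam P i b (U i) A p))//.
by apply/funext => a; apply/funext => b; rewrite (tD_eqv _ _ hU UV).
Qed.

Lemma tD_lin (x z : R) U V i a A p : smooth_field U -> smooth_field V ->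
  cdom i p ->
  tD g Gam P i a (fun B q => x * U i B q + z * V i B q) A p =
  x * tD g Gam P i a (U i) A p + z * tD g Gam P i a (V i) A p.
Proof.
move=> hU hV ip.
have o := @openT M.
have sU B : sm i setT (U i B) by rewrite sm_setT.
have sV B : sm i setT (V i B) by rewrite sm_setT.
rewrite (@tD_add _ _ _ _ _ _ _ i setT)//; try by apply: sm_mul => //; exact: sm_cst.
rewrite !(@tD_mul _ _ _ _ _ _ _ i setT a (fun=> _) 0)//; try exact: ispd_cst.
by rewrite !mul0r !addr0.
Qed.

Lemma tlap_lin (x z : R) U V i A p : smooth_field U -> smooth_field V ->
  cdom i p ->
  tlap g Gam P i (fun B q => x * U i B q + z * V i B q) A p =
  x * tlap g Gam P i (U i) A p + z * tlap g Gam P i (V i) A p.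
Proof.
move=> hU hV ip; rewrite /tlap -!gtraceZ -gtraceD; congr gtrace.
apply/funext => a; apply/funext => b; rewrite /tD2.
pose L : tfield M k := fun i B q =>
  x * tD g Gam P i b (U i) B q + z * tD g Gam P i b (V i) B q.
have -> : tD g Gam P i a (tD g Gam P i b
      (fun B q => x * U i B q + z * V i B q)) A p =
    x * tD g Gam P i a (tD g Gam P i b (U i)) A p +
    z * tD g Gam P i a (tD g Gam P i b (V i)) A p.
  rewrite -(@tD_lin x z (fun i => tD g Gam P i b (U i))
    (fun i => tD g Gam P i b (V i)))//; try by move=> *; exact: smooth_tD.
  apply: (@tD_near _ _ _ _ _ _ _ i setT) => //; first exact: openT.
    have o := @openT M.
    have sD (W : tfield M k) B : smooth_field W -> sm i setT (tD g Gam P i b (W i) B).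
      by move=> hW; rewrite sm_setT; exact: smooth_tD.
    have sc (t : R) : sm i setT (fun=> t) by exact: sm_cst.
    by move=> B; apply: sm_add => //; apply: sm_mul => //; exact: sD.
  by move=> B q iq _; rewrite tD_lin.
under [X in _ - X]eq_bigr do rewrite tD_lin// mulrDr !(mulrCA (Gam _ _ _ _ _)).
by rewrite big_split/= -!mulr_sumr; ring.
Qed.

Lemma opy_lin w (x z : R) U V : smooth_field U -> smooth_field V ->
  eqv (y w (fun i A p => x * U i A p + z * V i A p))
      (fun i A p => x * y w U i A p + z * y w V i A p).
Proof.
move=> hU hV i A p ip; rewrite /opy /IdotD tlap_lin//.
rewrite (_ : (fun a b => nu s i a p *
      tD g Gam P i b (fun B q => x * U i B q + z * V i B q) A p) = (fun a b =>
    x * (nu s i a p * tD g Gam P i b (U i) A p) +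
    z * (nu s i a p * tD g Gam P i b (V i) A p))); last first.
  by apply/funext => a; apply/funext => b; rewrite tD_lin//; ring.
rewrite gtraceD !gtraceZ; ring.
Qed.

(* The commutation relation [x, y] = h. *)
Lemma opy_opx w V : smooth_field V ->
  eqv (y (w + 1) (opx s V))
      (fun i A p => opx s (y w V) i A p - oph w V i A p).
Proof.
move=> hV i A p ip; have I0 := hI ip.
have o := @openT M.
(* Leibniz with phi = s, psi = 1, chi = 0. Beyond s I.D V there remains (d + 2 w)(N + 2 s rho) V =
   (d + 2 w) I^2 V, which the factor -1/I^2 turns into -h V. *)
rewrite /opy /opx (@IdotD_phi _ _ _ _ _ _ _ hg hGam hP hs i setT _ s (fun=> 1) 0)//.
- rewrite /oph /IdotD.
  set G := gtrace g i _ p; set L := tlap _ _ _ _ _ _ _; set J := Jtrace _ _ _ _.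
  set I := Isq _ _ _ _ _ _; set r := rho _ _ _ _ _ _.
  by field.
- by move=> B; rewrite sm_setT.
- by rewrite sm_setT.
- exact: sm_cst.
- move=> a q iq _; rewrite mul1r; apply: (@sm_ispd _ _ _ i setT) => //.
  by rewrite sm_setT.
- by move=> a; rewrite mul0r; exact: ispd_cst.
Qed.

(** The coefficient of |nu|^2 is a multiple of al (d + 2 w - 1 - al), which vanishes. With w' = w -
    al = -d - w + 1, the gradient gets d + 2 w - 2 - 2 al = d + 2 w' - 2, [rho] gets w (d + 2 w - 2)
    + al d = w' (d + 2 w' - 2), and J gets w': the coefficients of I.D at weight w'. *)
Lemma opy_spow w (V : tfield M k) i A p : smooth_field V -> cdom i p ->
  s p != 0 ->
  y w (fun i A q => spow (s q) (d%:R + 2 * w - 1) * V i A q) i A p =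
  spow (s p) (d%:R + 2 * w - 1) * y (- d%:R - w + 1) V i A p.
Proof.
move=> hV ip s0; set al := _ - 1.
(* The power is smooth only off the zeros of [s]; this set is open, so derivatives can be taken
   inside it. *)
pose W := [set q | s q != 0] : set M.
have oW : open W.
  rewrite openE => q /= sq0; have [j jq] := cdom_cover q.
  have cs : {for q, continuous s}.
    by apply: (@sm_continuous _ _ _ j setT) => //; rewrite sm_setT.
  have := @cvgr_neq0 R R M (nbhs q) _ s (s q) cs sq0; exact.
have sn q i' : cdom i' q -> W q -> s q != 0 by [].
have ss i' : sm i' W s by apply: sm_in; exact: hs.
have sphi : sm i W (fun q => spow (s q) al) by apply: sm_spow => // q ? ?; exact: sn.
have spsi : sm i W (fun q => al * spow (s q) al / s q).
  apply: sm_mul => //; first by apply: sm_mul => //; exact: sm_cst.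
  by apply: sm_inv => // q ? ?; exact: sn.
have dphi a q : cdom i q -> W q ->
    ispd i a (fun q => spow (s q) al) q (al * spow (s q) al / s q * nu s i a q).
  move=> iq Wq; apply: (@ispd_comp1 _ _ _ i a s (fun z => spow z al)) => //.
    exact: (sm_ispd a (ss i) iq Wq).
  exact: is_derive_spow.
have dinv a : ispd i a (fun q => (s q)^-1) p (- (s p)^-1 ^+ 2 * nu s i a p).
  apply: (@ispd_comp1 _ _ _ i a s (fun z => z^-1)) => //.
    exact: (sm_ispd a (ss i) ip s0).
  apply: is_derive_eq; first exact: (is_derive_fV s0 (is_derive_id _ _)).
  by rewrite mulr1.
have dpsi a : ispd i a (fun q => al * spow (s q) al / s q) p
    (al * (al - 1) * spow (s p) al / s p / s p * nu s i a p).
  apply: (ispd_eq (ispdM ip (ispdZ al ip (dphi a p ip s0)) (dinv a))).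
  by field.
rewrite /opy (@IdotD_phi _ _ _ _ _ _ _ hg hGam hP hs i W _ (fun q => spow (s q) al)
  (fun q => al * spow (s q) al / s q) (al * (al - 1) * spow (s p) al / s p / s p))//.
  have I0 := hI ip; rewrite /IdotD.
  set G := gtrace g i _ p; set L := tlap _ _ _ _ _ _ _; set J := Jtrace _ _ _ _.
  set I := Isq _ _ _ _ _ _; set r := rho _ _ _ _ _ _.
  rewrite -/I in I0; rewrite /al; field.
  by rewrite s0 I0.
by move=> B; apply: sm_in; exact: hV.
Qed.

End Fields.

End Algebra.

Lemma iota1_map l : iota 1 l = map S (iota 0 l).
Proof. by rewrite -[1%N]addn0 iotaDl; exact: eq_map. Qed.

(** * Products of the operators c_j *)

Section Factorization.
Variables (R : realType) (d : nat) (M : manifold R d).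
Variables (g : field2 M) (Gam : christoffel M) (P : field2 M) (s : M -> R).
Hypothesis d0 : (0 < d)%N.
Hypotheses (hg : is_metric g) (hGam : is_levi_civita g Gam) (hP : is_field2 P).
Hypothesis hs : smooth_fun s.
Hypothesis hI : forall i p, cdom i p -> Isq g Gam P s i p != 0.
Variable Phi : bundle R.
Implicit Types (i : chart M) (p : M) (U V : tfield M (rank Phi)) (kap : nat -> R).
Notation idx := (tidx d).
Notation y := (opy g Gam P s).
Notation opc := (opc g Gam P s).

Lemma gsec_smooth V : gsec g V -> forall i A, smooth_in i (V i A).
Proof. by case. Qed.
Hint Resolve gsec_smooth : core.

Lemma gsec_y w V : gsec g V -> gsec g (y w V).
Proof. exact: gsec_opy. Qed.

Lemma gsec_opc w j V : gsec g V -> gsec g (opc w j V).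
Proof.
move=> hV; apply: gsecD; first by apply: gsec_opx => //; exact: gsec_y.
apply: (gsecZ (iscal_cst _ _)); apply: gsecD; first exact: (gsecZ (iscal_cst _ _)).
by apply: gsecN; exact: (gsecZ (iscal_cst _ _)).
Qed.

(** The factor 1 produces the linear combination that [opy_lin] accepts. *)
Lemma opcE w j V : opc w j V = fun i A p =>
  1 * opx s (y w V) i A p + j%:R * (d%:R + 2 * w - j%:R - 1) * V i A p.
Proof.
apply/funext => i; apply/funext => A; apply/funext => p.
rewrite /Defs.opc /oph; ring.
Qed.

Lemma opc_eqv w j U V : gsec g U -> eqv U V -> eqv (opc w j U) (opc w j V).
Proof.
move=> hU UV i A p ip; rewrite !opcE /opx (UV i A p ip).
by rewrite (opy_eqv s hg hGam hP w (gsec_smooth hU) UV).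
Qed.

Lemma opy_scale w x U : gsec g U ->
  eqv (y w (fun i A p => x * U i A p)) (fun i A p => x * y w U i A p).
Proof.
move=> hU i A p ip.
have E : (fun i A p => x * U i A p) = (fun i A p => x * U i A p + 0 * U i A p).
  by do 3 apply/funext => ?; rewrite mul0r addr0.
by rewrite E (opy_lin s hg hGam hP)//; [rewrite mul0r addr0|exact: gsec_smooth..].
Qed.

Lemma opy_opc w j V : gsec g V ->
  eqv (y w (opc w j.+1 V)) (opc (w - 1) j (y w V)).
Proof.
move=> hV i A p ip; rewrite !opcE.
have hy := gsec_y w hV.
rewrite (opy_lin s hg hGam hP)//; [|exact: gsec_smooth (gsec_opx hs hy)|exact: gsec_smooth].
(* The relation is applied to [y V], of weight w - 1, and contributes the scalar -(d + 2 w - 2). *)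
have := opy_opx d0 hg hGam hP hs hI (w - 1) (gsec_smooth hy) A ip.
by rewrite subrK => ->; rewrite /oph -natr1; ring.
Qed.

(** The constants are separate from the indices because moving [y] across lowers every index while
    each constant stays in place, so that [kap] becomes [kap \o S]. *)
Definition cprod w kap (js : seq nat) V : tfield M (rank Phi) :=
  foldr (fun j U => fun i A p => kap j * opc w j U i A p) V js.

Lemma gsec_cprod w kap js V : gsec g V -> gsec g (cprod w kap js V).
Proof.
move=> hV; elim: js => //= j js IH.
exact/(gsecZ (iscal_cst _ _))/gsec_opc.
Qed.

Lemma opy_cprod w kap js V : gsec g V ->
  eqv (y w (cprod w kap (map S js) V))
      (cprod (w - 1) (kap \o S) js (y w V)).
Proof.
move=> hV; elim: js => //= j js IH i A p ip.
have hU := gsec_cprod w kap (map S js) hV.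
rewrite opy_scale//; last exact: gsec_opc.
by congr (_ * _); rewrite opy_opc//; apply: opc_eqv => //; exact: gsec_y.
Qed.

(** The outermost factor has index 0 and is a multiple of x y. Its [y], moved to the right, turns
    the indices 1, ..., l-1 into 0, ..., l-2 at weight w - 1, and induction applies to [y U]: each
    round frees one power of [s]. *)
Lemma cprod_iota0 l w kap U : gsec g U -> exists2 r, gsec g r &
  eqv (cprod w kap (iota 0 l) U) (fun i A p => s p ^+ l * r i A p).
Proof.
elim: l w kap U => [|l IH] w kap U hU.
  by exists U => // i A p _; rewrite mul1r.
have [r hr E] := IH (w - 1) (kap \o S) (y w U) (gsec_y w hU).
exists (fun i A p => kap 0%N * r i A p); first exact: (gsecZ (iscal_cst _ _)).
move=> i A p ip; rewrite /= iota1_map.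
rewrite /Defs.opc mul0r addr0 /opx (opy_cprod w kap _ hU)// E// exprS; ring.
Qed.

(** The hypothesis on [kap] makes every factor 1 + kap j x y. All terms other than [V] therefore
    start with [x] and are collected in [G]. *)
Lemma cprod_expand w kap js V : gsec g V ->
  (forall j, j \in js -> kap j * (j%:R * (d%:R + 2 * w - j%:R - 1)) = 1) ->
  exists2 G, gsec g G &
    forall i A p, cprod w kap js V i A p = V i A p + s p * G i A p.
Proof.
move=> hV; elim: js => [|j js IH] hk.
  exists (fun i A p => 0 * V i A p); first exact: (gsecZ (iscal_cst _ _)).
  by move=> i A p; rewrite mul0r mulr0 addr0.
have [|G hG E] := IH; first by move=> j' h; apply: hk; rewrite inE h orbT.
exists (fun i A p => G i A p + kap j * y w (cprod w kap js V) i A p).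
  apply: gsecD => //; apply: (gsecZ (iscal_cst _ _)).
  exact/gsec_y/gsec_cprod.
move=> i A p; have k1 := hk j (mem_head j js).
rewrite /= opcE mulrDr [X in _ + X]mulrA k1 E /opx; ring.
Qed.

End Factorization.

(** * The expansion and the order of vanishing of its image under y *)

Theorem proposition2p29 (R : realType) (d : nat) (hd : (3 <= d)%N)
    (M : manifold R d) (c : set (field2 M)) (sigma : density M)
    (hAR : is_almost_riemannian c sigma)
    (hdef : is_defining_density c sigma)
    (g : field2 M) (hg : c g)
    (Gam : christoffel M) (hGam : is_levi_civita g Gam)
    (P : field2 M) (hP : is_schouten g Gam P)
    (hI : forall i p, cdom i p -> Isq g Gam P (sigma g) i p != 0)
    (Phi : bundle R) (w0 h0 : R) (hh0 : h0 = d%:R + 2 * w0)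
    (hh0n : forall n : nat, h0 != - n%:R)
    (f0 : tsection M Phi) (hf0 : is_section c (- d%:R - w0 + 1) f0)
    (l : nat) :
  let fl : tfield M (rank Phi) := fun i A p =>
    spow (sigma g p) (h0 - 1) *
    opc_prod g Gam P (sigma g) (- d%:R - w0 + 1) h0 l (f0 g) i A p in
  (exists (f : nat -> tsection M Phi) (r : tsection M Phi),
    [/\ f 0%N = f0,
        (forall m : nat, is_section c (- d%:R - w0 + 1 - m%:R) (f m)),
        is_section c (- d%:R - w0 + 1 - (l.+1)%:R) r &
        forall i A p, cdom i p -> ~ zero_locus c sigma p ->
          fl i A p = spow (sigma g p) (h0 - 1) *
            (\sum_(m < l.+1) sigma g p ^+ m * f m g i A p
             + sigma g p ^+ l.+1 * r g i A p)]) /\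
  (exists r : tsection M Phi,
    is_section c (w0 - 1 - (h0 - 1 + l%:R)) r /\
    forall i A p, cdom i p -> ~ zero_locus c sigma p ->
      opy g Gam P (sigma g) w0 fl i A p =
      spow (sigma g p) (h0 - 1) * sigma g p ^+ l * r g i A p).
Proof.
move=> fl.
have d0 : (0 < d)%N by exact: ltn_trans hd.
case: hAR => hc hsig _.
have hgm : is_metric g by case: hc => _ h _; exact: h.
have hs : smooth_fun (sigma g) by case: hsig => h _; exact: h.
case: hP => hP2 _.
have V0 := gsec_section hg hf0.
have off p : ~ zero_locus c sigma p -> sigma g p != 0.
  exact: (density_off_zero hc hg hsig).
set w := - d%:R - w0 + 1.
pose kap (j : nat) : R := (j%:R * (1 - j%:R - h0))^-1.
have hk j : j \in iota 1 l -> kap j * (j%:R * (d%:R + 2 * w - j%:R - 1)) = 1.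
  rewrite mem_iota => /andP[j1 _].
  have -> : d%:R + 2 * w - j%:R - 1 = 1 - j%:R - h0 by rewrite hh0 /w; ring.
  rewrite mulVf// mulf_neq0 ?pnatr_eq0 -?lt0n//.
  (* A zero of 1 - j - h0 would give h0 = -(j - 1), excluded as j >= 1. *)
  apply: contraNneq (hh0n j.-1) => /eqP; rewrite subr_eq0 => /eqP <-.
  by rewrite -{1}(prednK j1) -natr1; apply/eqP; ring.
pose ex v (V : tfield M (rank Phi)) : tsection M Phi := extend g v V.
have hex v V : gsec g V -> is_section c v (ex v V).
  by move=> hV; exact: (is_section_extend d0 hc hg).
have exE v V i A p : ex v V g i A p = V i A p by exact: (extend_id d0 hc hg).
split.
- have [G hG E] := cprod_expand hgm hGam hP2 hs hI V0 hk.
  pose Z : tfield M (rank Phi) := fun i A p => 0 * f0 g i A p.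
  have hZ : gsec g Z by exact: (gsecZ (iscal_cst _ _)).
  (* The higher coefficients are only required to be sections, so [G] serves as f_1 and zero as all
     later ones. At m = 0 the given [f0] is kept in all scales, not rebuilt from its components in
     [g]. *)
  pose f (m : nat) : tsection M Phi :=
    if m == 0%N then f0 else ex (w - m%:R) (if m == 1%N then G else Z).
  (* For l = 0 the sum ends with f_0, so [G] becomes the remainder; otherwise the remainder is
     zero. *)
  exists f, (ex (w - l.+1%:R) (if l == 0%N then G else Z)); split => //.
  + move=> [|[|m]]; [by rewrite /f/= subr0|exact: hex..].
  + by apply: hex; case: ifP.
  + move=> i A p ip pz; rewrite /fl; congr (_ * _).
    rewrite -[LHS]/(cprod g Gam P (sigma g) w kap (iota 1 l) (f0 g) i A p) E exE.
    rewrite big_ord_recl expr0 mul1r -addrA; congr (_ + _).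
    case: (l) => [|l']; first by rewrite big_ord0 add0r expr1.
    rewrite big_ord_recl/= big1.
      by rewrite /f/= exE /Z mul0r mulr0 !addr0 expr1.
    by move=> m _; rewrite /f/= exE /Z mul0r mulr0.
- have yV0 := gsec_y hgm hGam hP2 hs hI w V0.
  have [r hr E] := cprod_iota0 d0 hgm hGam hP2 hs hI l (w - 1) (kap \o S) yV0.
  (* This weight equals w - 1 - l: one unit is lost to [y] and one to each power of sigma split
     off. *)
  exists (ex (w0 - 1 - (h0 - 1 + l%:R)) r); split; first exact: hex.
  move=> i A p ip pz; rewrite exE /fl.
  have hU i' A' :
      smooth_in i' (opc_prod g Gam P (sigma g) w h0 l (f0 g) i' A').
    by apply: gsec_smooth; exact: (gsec_cprod hgm hGam hP2 hs hI w kap (iota 1 l) V0).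
  have := opy_spow d0 hgm hGam hP2 hs hI w0 A hU ip (off p pz).
  rewrite -hh0 => ->; rewrite -mulrA; congr (_ * _).
  (* From here the chain is read backwards: s^l r is the product over 0, ..., l-1 applied to y f0,
     which is [y] of the product over 1, ..., l applied to f0. *)
  rewrite -E//.
  rewrite -(opy_cprod d0 hgm hGam hP2 hs hI w kap (iota 0 l) V0)//.
  by rewrite -iota1_map.
Qed.
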